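(* If $(e_j)_{j\in J}$ is a (countable) right $C^*$-module frame of $L^2(\mathcal{G}_X,\sigma)$, then for all $x\in X$ the set $\{(e_j)_x^\alpha\}_{j\in J,\ \alpha\in r^{-1}(x)}$ is a normalised tight frame of $\mathfrak{h}_x$.
   Context: Setting. $\mathcal{G}$ is a second countable, locally compact, Hausdorff groupoid with Haar system $\{\nu^u\}_{u\in\mathcal{G}^{(0)}}$. $X\subset\mathcal{G}^{(0)}$ is a compact abstract transversal: $X$ is closed, meets every $\mathcal{G}$-orbit in $\mathcal{G}^{(0)}$, and for $\mathcal{G}_X=\{\gamma\in\mathcal{G}:s(\gamma)\in X\}$ with the relative topologies the maps $r:\mathcal{G}_X\to\mathcal{G}^{(0)}$ and $s:\mathcal{G}_X\to X$ are open. $\mathcal{H}=\{\gamma\in\mathcal{G}_X:r(\gamma)\in X\}$ is assumed étale, $\mathcal{H}^{(0)}=X$. $\sigma_{\mathcal{G}}:\mathcal{G}^{(2)}\to\mathbb{T}$ is a continuous normalised 2-cocycle: $\sigma_{\mathcal G}(\gamma,\xi)\sigma_{\mathcal G}(\gamma\xi,\eta)=\sigma_{\mathcal G}(\gamma,\xi\eta)\sigma_{\mathcal G}(\xi,\eta)$, $\sigma_{\mathcal G}(\gamma,s(\gamma))=1=\sigma_{\mathcal G}(r(\gamma),\gamma)$ and $\sigma_{\mathcal G}(\gamma,\gamma^{-1})=1$; $\sigma_{\mathcal{H}}$ is its restriction to $\mathcal{H}$. $C_c(\mathcal{G}_X)$ is a bimodule over the twisted convolution algebras $C_c(\mathcal{G},\sigma_{\mathcal{G}})$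 and $C_c(\mathcal{H},\sigma_{\mathcal{H}})$: $(f\cdot e)(z)=\int_{\mathcal{G}}f(\gamma)e(\gamma^{-1}z)\sigma_{\mathcal{G}}(\gamma,\gamma^{-1}z)\,d\nu^{r(z)}(\gamma)$, $(e\cdot g)(z)=\sum_{\eta\in r^{-1}(s(z))}e(z\eta)g(\eta^{-1})\sigma_{\mathcal{G}}(z\eta,\eta^{-1})$, $(e_1\mid e_2)_{\mathcal{H}}(\eta)=\int_{\mathcal{G}}\overline{e_1(\gamma^{-1}z)}e_2(\gamma^{-1}z\eta)\sigma_{\mathcal{G}}(z^{-1}\gamma,\gamma^{-1}z\eta)\,d\nu^{r(z)}(\gamma)$ with $s(z)=r(\eta)$. It completes to a Morita equivalence bimodule $L^2(\mathcal{G}_X,\sigma)$ between $C^*_r(\mathcal{G},\sigma_{\mathcal{G}})$ and $C^*_r(\mathcal{H},\sigma_{\mathcal{H}})$. A countable set $(e_j)$ is a right $C^*$-module frame of a right $C^*$-module $E$ if $\sum_j\Theta^R_{e_j,e_j}$ converges strictly to $\mathrm{Id}_E$, where $\Theta^R_{e_1,e_2}(e)=e_1\cdot(e_2\mid e)$. A normalised tight frame of a Hilbert space is a family $\{g_i\}$ with $\sum_i|\langle g_i,\psi\rangle|^2=\|\psi\|^2$ for all $\psi$. For $x\in X$, $\mathfrak{h}_x$ is the Hilbert space completion of $L^2(\mathcal{G}_X,\sigma)$ in $\langle e_1,e_2\rangle_x=\omega_x((e_1\mid e_2)_{\mathcal{H}})$, with $\omega_x$ the state extending $f\mapsto f(x)$,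 $f\in C_c(\mathcal{H},\sigma_{\mathcal{H}})$; elements of $\mathfrak{h}_x$ are $L^2$-functions on $s^{-1}(x)\subset\mathcal{G}_X$, and $e_x$ is the image of $e$. For $\alpha\in r^{-1}(x)\subset\mathcal{H}$, $e_x^\alpha(y)=e(y\alpha)\,\sigma_{\mathcal{G}}(y\alpha,\alpha^{-1})$ for $y\in s^{-1}(x)$. *)

(* Defs.v *)
From HB Require Import structures.
From mathcomp Require Import all_boot all_order all_algebra finmap complex.
From mathcomp Require Import all_classical all_reals all_analysis.
From mathcomp.analysis Require Import summability.
Set Implicit Arguments.
Unset Strict Implicit.
Unset Printing Implicit Defensive.
Import Order.TTheory GRing.Theory Num.Theory.
Import numFieldNormedType.Exports.
Local Open Scope classical_set_scope.
Local Open Scope ring_scope.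

(* [complex R] seen through its [numClosedFieldType] structure, so that the
   norm topology and the normed modules of MathComp-Analysis apply to it. *)
Definition Cplx (R : realType) : numClosedFieldType := complex R.

Definition re (R : realType) (z : Cplx R) : R := complex.Re (z : complex R).
Definition im (R : realType) (z : Cplx R) : R := complex.Im (z : complex R).
Definition mkC (R : realType) (a b : R) : Cplx R := Complex a b.
Definition realC (R : realType) (a : R) : Cplx R := mkC a 0.

Definition sqabs (R : realType) (z : Cplx R) : R := re z ^+ 2 + im z ^+ 2.

Definition cintegral (R : realType) d (T : measurableType d)
    (mu : {measure set T -> \bar R}) (D : set T) (f : T -> Cplx R) : Cplx R :=
  mkC (\int[mu]_(t in D) re (f t)) (\int[mu]_(t in D) im (f t)).

(* Continuous compactly supported functions on the subspace [A], encoded as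
   functions on the ambient space which vanish outside [A]. *)
Definition Cc (R : realType) (T : topologicalType) (A : set T)
    (f : T -> Cplx R) : Prop :=
  {within A, continuous f} /\
  exists K, [/\ compact K, K `<=` A & forall t, ~ K t -> f t = 0].

Definition linear_on (R : realType) (T : Type) (V : lmodType (Cplx R))
    (D : set (T -> Cplx R)) (i : (T -> Cplx R) -> V) : Prop :=
  forall (a : Cplx R) f g, D f -> D g ->
    i (fun t => a * f t + g t) = a *: i f + i g.

Record cstarAlgebra (R : realType) := CStarAlgebra {
  cs_car :> completeNormedModType (Cplx R);
  cs_mul : cs_car -> cs_car -> cs_car;
  cs_star : cs_car -> cs_car;
  cs_mulA : forall a b c, cs_mul a (cs_mul b c) = cs_mul (cs_mul a b) c;
  cs_mulDl : forall (k : Cplx R) a b c,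
    cs_mul (k *: a + b) c = k *: cs_mul a c + cs_mul b c;
  cs_mulDr : forall (k : Cplx R) a b c,
    cs_mul c (k *: a + b) = k *: cs_mul c a + cs_mul c b;
  cs_starK : forall a, cs_star (cs_star a) = a;
  cs_starD : forall (k : Cplx R) a b,
    cs_star (k *: a + b) = k^* *: cs_star a + cs_star b;
  cs_starM : forall a b, cs_star (cs_mul a b) = cs_mul (cs_star b) (cs_star a);
  cs_normM : forall a b, `|cs_mul a b| <= `|a| * `|b|;
  cs_norm_star : forall a, `|cs_mul (cs_star a) a| = `|a| ^+ 2 }.

Definition cs_state (R : realType) (A : cstarAlgebra R) (w : A -> Cplx R) : Prop :=
  [/\ forall (k : Cplx R) a b, w (k *: a + b) = k * w a + w b,
      forall a, 0 <= w (cs_mul (cs_star a) a),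
      forall a, `|w a| <= `|a| &
      forall eps : Cplx R, 0 < eps -> exists2 a, `|a| <= 1 & 1 - eps < `|w a|].

Record hilbertModule (R : realType) (A : cstarAlgebra R) := HilbertModule {
  hm_car :> completeNormedModType (Cplx R);
  hm_act : hm_car -> A -> hm_car;
  hm_ip : hm_car -> hm_car -> A;
  hm_actA : forall e a b, hm_act e (cs_mul a b) = hm_act (hm_act e a) b;
  hm_actDl : forall (k : Cplx R) e f a,
    hm_act (k *: e + f) a = k *: hm_act e a + hm_act f a;
  hm_actDr : forall (k : Cplx R) e a b,
    hm_act e (k *: a + b) = k *: hm_act e a + hm_act e b;
  hm_ipDr : forall (k : Cplx R) e f g,
    hm_ip e (k *: f + g) = k *: hm_ip e f + hm_ip e g;
  hm_ipA : forall e f a, hm_ip e (hm_act f a) = cs_mul (hm_ip e f) a;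
  hm_ip_star : forall e f, cs_star (hm_ip e f) = hm_ip f e;
  hm_ip_pos : forall e, exists b, hm_ip e e = cs_mul (cs_star b) b;
  hm_norm : forall e, `|e| ^+ 2 = `|hm_ip e e| }.

Record hilbertSpace (R : realType) := HilbertSpace {
  hs_car :> completeNormedModType (Cplx R);
  hs_ip : hs_car -> hs_car -> Cplx R;
  hs_ipDr : forall (k : Cplx R) u v w,
    hs_ip u (k *: v + w) = k * hs_ip u v + hs_ip u w;
  hs_ip_conj : forall u v, (hs_ip u v)^* = hs_ip v u;
  hs_norm : forall u, `|u| ^+ 2 = hs_ip u u }.

Section Frames.
Context (R : realType) (A : cstarAlgebra R) (E : hilbertModule A).

Definition theta (e1 e2 : E) (e : E) : E := hm_act e1 (hm_ip e2 e).

Definition finite_rank (T : E -> E) : Prop :=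
  exists (n : nat) (u v : 'I_n -> E), forall e, T e = \sum_(i < n) theta (u i) (v i) e.

Definition compact_operator (K : E -> E) : Prop :=
  forall eps : Cplx R, 0 < eps ->
  exists2 T, finite_rank T & forall e, `|K e - T e| <= eps * `|e|.

(* Convergence in the strict topology of the multiplier algebra of the compact
   operators: (T_i - T) K and K (T_i - T) tend to 0 in operator norm for every
   compact K. *)
Definition strict_cvg (I : Type) (F : set_system I) (T_ : I -> E -> E)
    (T : E -> E) : Prop :=
  forall K, compact_operator K -> forall eps : Cplx R, 0 < eps ->
  \forall i \near F, forall e : E,
    `|T_ i (K e) - T (K e)| <= eps * `|e| /\
    `|K (T_ i e) - K (T e)| <= eps * `|e|.

(* The sum is over the directed set of finite subsets of the index type; its
   terms are positive, so that no enumeration has to be chosen. *)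
Definition module_frame (J : countType) (e_ : J -> E) : Prop :=
  strict_cvg totally
    (fun (B : {fset J}) e => \sum_(j <- B) theta (e_ j) (e_ j) e) (fun e => e).

End Frames.

Definition normalised_tight_frame (R : realType) (h : hilbertSpace R)
    (I : choiceType) (D : set I) (g : I -> h) : Prop :=
  forall psi : h,
    \esum_(i in D) (sqabs (hs_ip (g i) psi))%:E = (re (`|psi| ^+ 2))%:E.

(* The product is a total function, only meaningful on composable pairs; the
   unit space is the set of fixed points of [gr]. *)
Record groupoid (G : Type) := Groupoid {
  gr : G -> G;
  gs : G -> G;
  ginv : G -> G;
  gmul : G -> G -> G;
  g_rr : forall g, gr (gr g) = gr g;
  g_sr : forall g, gs (gr g) = gr g;
  g_rs : forall g, gr (gs g) = gs g;
  g_ss : forall g, gs (gs g) = gs g;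
  g_rM : forall g h, gs g = gr h -> gr (gmul g h) = gr g;
  g_sM : forall g h, gs g = gr h -> gs (gmul g h) = gs h;
  g_mulA : forall g h k, gs g = gr h -> gs h = gr k ->
    gmul (gmul g h) k = gmul g (gmul h k);
  g_mul1g : forall g, gmul (gr g) g = g;
  g_mulg1 : forall g, gmul g (gs g) = g;
  g_rV : forall g, gr (ginv g) = gs g;
  g_sV : forall g, gs (ginv g) = gr g;
  g_mulVg : forall g, gmul (ginv g) g = gs g;
  g_mulgV : forall g, gmul g (ginv g) = gr g }.

Definition units (G : Type) (Gd : groupoid G) : set G := [set u | gr Gd u = u].
Definition composable (G : Type) (Gd : groupoid G) : set (G * G) :=
  [set p | gs Gd p.1 = gr Gd p.2].

Record topological_groupoid (G : topologicalType) (Gd : groupoid G) : Prop := {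
  tg_r : continuous (gr Gd);
  tg_s : continuous (gs Gd);
  tg_inv : continuous (ginv Gd);
  tg_mul : {within composable Gd, continuous (fun p : G * G => gmul Gd p.1 p.2)} }.

Definition borel (G : ptopologicalType) := g_sigma_algebraType (@open G).

Section Setting.
Context (R : realType) (G : ptopologicalType) (Gd : groupoid G).
Local Notation r := (gr Gd).
Local Notation s := (gs Gd).
Local Notation inv := (ginv Gd).
Local Notation mul := (gmul Gd).

(* Expressions in [mul] are meaningful only on the fibre of [r] over [u], on
   which [nu u] is concentrated, hence the domain of integration. *)
Definition fibre_integral (nu : G -> {measure set (borel G) -> \bar R})
    (u : G) (f : G -> Cplx R) : Cplx R :=
  cintegral (nu u) [set g : borel G | r g = u] f.

(* Only the measures [nu u] with [u] a unit matter.  On a second countable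
   locally compact Hausdorff space, a Borel measure which is finite on compact
   sets is automatically regular. *)
Record haar_system (nu : G -> {measure set (borel G) -> \bar R}) : Prop := {
  haar_compact : forall u (K : set G), units Gd u -> compact K -> (nu u K < +oo)%E;
  (* the support of [nu u] is the fibre of [r] over [u] *)
  haar_supp : forall u (U : set G), units Gd u -> open U ->
    nu u U = 0%E <-> U `&` [set g | r g = u] = set0;
  haar_continuous : forall f : G -> Cplx R, Cc setT f ->
    {within units Gd, continuous (fun u => fibre_integral nu u f)};
  haar_invariant : forall (f : G -> Cplx R) g, Cc setT f ->
    fibre_integral nu (s g) (fun h => f (mul g h)) = fibre_integral nu (r g) f }.

Record normalised_cocycle (sigma : G -> G -> Cplx R) : Prop := {
  coc_norm : forall g h, s g = r h -> `|sigma g h| = 1;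
  coc_continuous :
    {within composable Gd, continuous (fun p : G * G => sigma p.1 p.2)};
  coc_assoc : forall g h k, s g = r h -> s h = r k ->
    sigma g h * sigma (mul g h) k = sigma g (mul h k) * sigma h k;
  coc_unitr : forall g, sigma g (s g) = 1;
  coc_unitl : forall g, sigma (r g) g = 1;
  coc_inv : forall g, sigma g (inv g) = 1 }.

Context (X : set G).

Definition GX : set G := [set g | X (s g)].
Definition HX : set G := [set g | X (s g) /\ X (r g)].

Record compact_transversal : Prop := {
  tr_units : X `<=` units Gd;
  tr_compact : compact X;
  tr_closed : closed X;
  tr_orbits : forall u, units Gd u -> exists2 g, r g = u & X (s g);
  tr_open_r : forall U, open U ->
    exists2 V, open V & r @` (U `&` GX) = V `&` units Gd;
  tr_open_s : forall U, open U -> exists2 V, open V & s @` (U `&` GX) = V `&` X }.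

(* The range map [HX -> X] is a local homeomorphism: on a neighbourhood of each
   point it is injective and open onto its image, which is open in [X]. *)
Definition etale_HX : Prop :=
  forall g, HX g -> exists U, [/\ open U, U g,
    set_inj (U `&` HX) r &
    forall V, open V -> exists2 W, open W & r @` (V `&` (U `&` HX)) = W `&` X].

Context (sigma : G -> G -> Cplx R) (nu : G -> {measure set (borel G) -> \bar R}).

Definition conv (f1 f2 : G -> Cplx R) (g : G) : Cplx R :=
  \sum_(z \in [set z | HX z /\ r z = r g])
    f1 z * f2 (mul (inv z) g) * sigma z (mul (inv z) g).

Definition invol (f : G -> Cplx R) (g : G) : Cplx R := (f (inv g))^*.

(* Supremum over [x] in [X] of the norms of the left regular representations
   xi |-> f * xi on l^2 of the fibre of [s] over [x] in [HX]. *)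
Definition reduced_norm (f : G -> Cplx R) : R :=
  let fib x : set G := [set g | HX g /\ s g = x] in
  Num.sqrt (fine (ereal_sup [set y | exists x (xi : G -> Cplx R),
    [/\ X x, forall g, ~ fib x g -> xi g = 0,
        (\esum_(g in fib x) (sqabs (xi g))%:E <= 1)%E &
        y = \esum_(g in fib x) (sqabs (conv f xi g))%:E]])).

(* (A, iA) is the completion of [Cc HX] in the reduced norm. *)
Record reduced_completion (A : cstarAlgebra R) (iA : (G -> Cplx R) -> A) : Prop := {
  rc_linear : linear_on (@Cc R G HX) iA;
  rc_mul : forall f1 f2, Cc HX f1 -> Cc HX f2 ->
    iA (conv f1 f2) = cs_mul (iA f1) (iA f2);
  rc_star : forall f, Cc HX f -> iA (invol f) = cs_star (iA f);
  rc_norm : forall f, Cc HX f -> `|iA f| = realC (reduced_norm f);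
  rc_dense : dense (iA @` @Cc R G HX) }.

Definition right_action (e f : G -> Cplx R) (z : G) : Cplx R :=
  \sum_(g \in [set g | HX g /\ r g = s z])
    e (mul z g) * f (inv g) * sigma (mul z g) (inv g).

Definition inner_at (e1 e2 : G -> Cplx R) (z eta : G) : Cplx R :=
  fibre_integral nu (r z) (fun g =>
    (e1 (mul (inv g) z))^* * e2 (mul (mul (inv g) z) eta) *
    sigma (mul (inv z) g) (mul (mul (inv g) z) eta)).

(* By left invariance the value does not depend on the choice of [z] with
   [s z = r eta]; we take the unit [z = r eta]. *)
Definition inner (e1 e2 : G -> Cplx R) : G -> Cplx R :=
  (fun eta => inner_at e1 e2 (r eta) eta) \_ HX.

(* (E, iE) is the completion of [Cc GX] in the norm of its inner product. *)
Record module_completion (A : cstarAlgebra R) (iA : (G -> Cplx R) -> A)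
    (E : hilbertModule A) (iE : (G -> Cplx R) -> E) : Prop := {
  mc_linear : linear_on (@Cc R G GX) iE;
  mc_act : forall e f, Cc GX e -> Cc HX f ->
    iE (right_action e f) = hm_act (iE e) (iA f);
  mc_inner : forall e1 e2, Cc GX e1 -> Cc GX e2 ->
    hm_ip (iE e1) (iE e2) = iA (inner e1 e2);
  mc_dense : dense (iE @` @Cc R G GX) }.

Definition evaluation_state (A : cstarAlgebra R) (iA : (G -> Cplx R) -> A)
    (x : G) (w : A -> Cplx R) : Prop :=
  cs_state w /\ forall f, Cc HX f -> w (iA f) = f x.

(* The fibre of [s] over [x] carries the image of [nu x] under inversion, so
   functions on this fibre are integrated after composition with [inv]. *)
Definition fibre_ae (x : G) (f1 f2 : G -> Cplx R) : Prop :=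
  {ae nu x, forall g : borel G, f1 (inv g) = f2 (inv g)}.

Definition fibre_L2 (x : G) (f : G -> Cplx R) : Prop :=
  [/\ measurable_fun setT (fun g : borel G => re (f g)),
      measurable_fun setT (fun g : borel G => im (f g)) &
      (\int[nu x]_g (sqabs (f (inv g)))%:E < +oo)%E].

Record fibre_space (A : cstarAlgebra R) (E : hilbertModule A) := FibreSpace {
  fs_space :> hilbertSpace R;
  fs_map : E -> fs_space;
  fs_fun : fs_space -> G -> Cplx R }.

(* [h] is the Hilbert space completion of [E] in w ((e1 | e2)).  The field
   [fs_fun] picks, for each vector, a representative of the L^2-function on the
   fibre of [s] over [x] which this vector is; by density and isometry, its
   class is determined by [fc_restr].  Equality of such functions is modulo
   [fibre_ae], and their values off the fibre are irrelevant. *)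
Record fibre_completion (A : cstarAlgebra R) (E : hilbertModule A)
    (iE : (G -> Cplx R) -> E) (x : G) (w : A -> Cplx R) (h : fibre_space E)
    : Prop := {
  fc_linear : forall (k : Cplx R) (e f : E),
    fs_map h (k *: e + f) = k *: fs_map h e + fs_map h f;
  fc_ip : forall e f : E, hs_ip (fs_map h e) (fs_map h f) = w (hm_ip e f);
  fc_dense : dense (range (fs_map h));
  fc_L2 : forall psi : h, fibre_L2 x (fs_fun psi);
  fc_isometry : forall psi phi : h,
    hs_ip psi phi =
    fibre_integral nu x (fun g => (fs_fun psi (inv g))^* * fs_fun phi (inv g));
  fc_restr : forall c, Cc GX c -> fibre_ae x (fs_fun (fs_map h (iE c))) c }.

(* For [y] in the fibre of [s] over [x], the product y alpha lies in the fibre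
   over [s alpha], so that [e] enters through its image over [s alpha].  A vector
   is determined by the class of its function, so [xget] has at most one choice. *)
Definition translate (A : cstarAlgebra R) (E : hilbertModule A)
    (h : G -> fibre_space E) (e : E) (x alpha : G) : h x :=
  xget (0 : h x) [set phi : h x | fibre_ae x (fs_fun phi)
    (fun y => fs_fun (fs_map (h (s alpha)) e) (mul y alpha) *
              sigma (mul y alpha) (inv alpha))].

End Setting.

(* Main.v *)
Require Import Defs.
From HB Require Import structures.
From mathcomp Require Import all_boot all_order all_algebra finmap complex.
From mathcomp Require Import all_classical all_reals all_analysis.
From mathcomp Require Import ring lra.
From mathcomp.analysis Require Import measurable_realfun summability.
Set Implicit Arguments.
Unset Strict Implicit.
Unset Printing Implicit Defensive.
Import Order.TTheory GRing.Theory Num.Theory.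
Import numFieldNormedType.Exports.
Local Open Scope classical_set_scope.
Local Open Scope ring_scope.

(** Fix a unit [x] in [X], write [w] for the state at [x], [M] for the map from
    the module [E] to the Hilbert space over [x], and [(e | f)] for the inner
    product of [E].  For each [alpha] in [HX] with range [x] let [b_alpha] be a
    continuous function on [HX] which, on the fibre of [s] over [x], is 1 at
    [alpha^-1] and 0 elsewhere.

    Acting by [b_alpha] translates by [alpha]: on compactly supported functions
    this is the formula for the action, and both operations are bounded, so the
    translate of [e] is [M (e . b_alpha)] for every [e] ([translateE]).  Here
    boundedness of the translation, and the very fact that it respects null
    sets, come from the invariance of the Haar system, which has to be extended
    from compactly supported functions to Borel sets ([haar_translation]).
    Hence, for [f] in [E],

      <translate of e_j by alpha, M f> = w (b_alpha^* (e_j | f)).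

    In the representation space of [w] the point masses [b_alpha] form an
    orthonormal basis: for [a] in [Cc HX] the number [w (b_alpha^* a)] is the
    value of [a] at [alpha^-1], and [w (a^* a)] is the sum of the squares of
    these values ([state_parseval]).  This uses that convolution preserves
    [Cc HX], because only there the state is known to be evaluation at [x]; that
    in turn rests on [fibre_sum_continuous].  Summing over [alpha] and then over
    [j] gives

      sum_j w ((f | e_j) (e_j | f)) = lim_B w ((f | T_B f)),

    with [T_B] the partial sums of the frame operator, and this limit is
    [w (f | f)], the squared norm of [M f], whenever [T_B f] tends to [f]
    ([reconstructed_energy]).

    Strict convergence gives [T_B f --> f] directly only for [f] in the range of
    a compact operator.  Sums of vectors [theta u v g] suffice, since their
    images are dense in the Hilbert space over [x] ([rank_one_dense]): starting
    from [e] in the unit ball, iterate the positive operator [1 - theta e e];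
    positivity of [w] and Kadison's inequality make the residuals tend to 0 in
    the seminorm of [w].  A Parseval identity which holds on a dense subspace
    holds everywhere ([parseval_dense]), which settles the remaining vectors. *)

(** * Complex numbers and real-valued norms *)

Section ComplexNumbers.
Context {R : realType}.
Implicit Types (a b z w : Cplx R) (t : R).

Lemma Cplx_eqP z w : re z = re w -> im z = im w -> z = w.
Proof. by case: z w => [? ?] [? ?] /= -> ->. Qed.

Lemma re0 : re (0 : Cplx R) = 0. Proof. by []. Qed.
Lemma im0 : im (0 : Cplx R) = 0. Proof. by []. Qed.
Lemma re1 : re (1 : Cplx R) = 1. Proof. by []. Qed.
Lemma im1 : im (1 : Cplx R) = 0. Proof. by []. Qed.
Lemma reD z w : re (z + w) = re z + re w.
Proof. by case: z w => [? ?] [? ?]. Qed.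
Lemma imD z w : im (z + w) = im z + im w.
Proof. by case: z w => [? ?] [? ?]. Qed.
Lemma reN z : re (- z) = - re z. Proof. by case: z. Qed.
Lemma imN z : im (- z) = - im z. Proof. by case: z. Qed.
Lemma reB z w : re (z - w) = re z - re w. Proof. by rewrite reD reN. Qed.
Lemma imB z w : im (z - w) = im z - im w. Proof. by rewrite imD imN. Qed.
Lemma reM z w : re (z * w) = re z * re w - im z * im w.
Proof. by case: z w => [? ?] [? ?]. Qed.
Lemma imM z w : im (z * w) = re z * im w + im z * re w.
Proof. by case: z w => [? ?] [? ?]. Qed.
Lemma re_conj z : re z^* = re z. Proof. by case: z. Qed.
Lemma im_conj z : im z^* = - im z. Proof. by case: z. Qed.
Lemma re_sum I (s : seq I) (P : pred I) (F : I -> Cplx R) :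
  re (\sum_(i <- s | P i) F i) = \sum_(i <- s | P i) re (F i).
Proof. exact: (big_morph _ reD re0). Qed.

Lemma leCE z w : (z <= w) = (im w == im z) && (re z <= re w).
Proof. by case: z w => [? ?] [? ?]. Qed.
Lemma ltCE z w : (z < w) = (im w == im z) && (re z < re w).
Proof. by case: z w => [? ?] [? ?]. Qed.

Lemma realCM t u : realC (t * u) = realC t * realC u :> Cplx R.
Proof. by apply: Cplx_eqP; rewrite ?reM ?imM /= !mul0r ?mulr0 ?subr0 ?addr0. Qed.

Lemma normCE z : `|z| = realC (Num.sqrt (sqabs z)).
Proof. exact: normc_def. Qed.
Lemma sqabs_ge0 z : 0 <= sqabs z.
Proof. by rewrite /sqabs addr_ge0 ?sqr_ge0. Qed.
Lemma re_norm2 z : re `|z| ^+ 2 = sqabs z.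
Proof. by rewrite normCE sqr_sqrtr ?sqabs_ge0. Qed.
Lemma sqabsM z w : sqabs (z * w) = sqabs z * sqabs w.
Proof. by rewrite /sqabs reM imM; ring. Qed.
Lemma re_conjM z w : re (z^* * w) = re z * re w + im z * im w.
Proof. by rewrite reM re_conj im_conj mulNr opprK. Qed.
Lemma conjM_sqabs z : z^* * z = realC (sqabs z).
Proof.
by apply: Cplx_eqP; rewrite ?re_conjM /= /sqabs ?imM ?re_conj ?im_conj; ring.
Qed.
Lemma sqabs1 z : `|z| = 1 -> sqabs z = 1.
Proof. by rewrite -re_norm2 => ->; rewrite re1 expr1n. Qed.
Lemma sqabsB z w : sqabs (z - w) = sqabs z + sqabs w - 2 * re (z^* * w).
Proof. by rewrite /sqabs re_conjM reB imB; ring. Qed.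
Lemma sqabs_eq0 z : sqabs z = 0 -> z = 0.
Proof.
move=> h; apply/eqP; rewrite -normr_eq0; apply/eqP.
by rewrite normCE h sqrtr0.
Qed.

(** The weights [1 + t] and [1 + 1/t] replace the triangle inequality for the
    norm, so that sums of squares can be compared term by term. *)
Lemma sqabsD_le t z w : 0 < t ->
  sqabs (z + w) <= (1 + t) * sqabs z + (1 + t^-1) * sqabs w.
Proof.
move=> t0; rewrite /sqabs reD imD.
have key (a b : R) : (a + b) ^+ 2 <= (1 + t) * a ^+ 2 + (1 + t^-1) * b ^+ 2.
  rewrite -subr_ge0.
  have -> : (1 + t) * a ^+ 2 + (1 + t^-1) * b ^+ 2 - (a + b) ^+ 2 =
     t^-1 * (t * a - b) ^+ 2 by field; rewrite gt_eqF.
  by rewrite mulr_ge0 ?sqr_ge0 ?invr_ge0 ?ltW.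
by apply: le_trans (lerD (key (re z) (re w)) (key (im z) (im w))) _; lra.
Qed.

Lemma abs_re_le z : `|re z| <= re `|z|.
Proof.
rewrite normCE /= -[leLHS]sqrtr_sqr ler_sqrt ?sqabs_ge0 //.
by rewrite /sqabs lerDl sqr_ge0.
Qed.
Lemma abs_im_le z : `|im z| <= re `|z|.
Proof.
rewrite normCE /= -[leLHS]sqrtr_sqr ler_sqrt ?sqabs_ge0 //.
by rewrite /sqabs lerDr sqr_ge0.
Qed.

Lemma realC_gt0 t : (0 < realC t :> Cplx R) = (0 < t).
Proof. by rewrite ltCE /= eqxx. Qed.
Lemma realC_le t u : (realC t <= realC u :> Cplx R) = (t <= u).
Proof. by rewrite leCE /= eqxx. Qed.
Lemma gt0_realC z : 0 < z -> z = realC (re z).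
Proof. by rewrite ltCE => /andP[/eqP h _]; apply: Cplx_eqP. Qed.
Lemma ge0_realC z : 0 <= z -> z = realC (re z).
Proof. by rewrite leCE => /andP[/eqP h _]; apply: Cplx_eqP. Qed.

Lemma continuous_re : continuous (@re R : Cplx R -> R).
Proof.
move=> z; apply/(@cvgrPdist_lt _ _ _ (nbhs z)) => e e0.
apply/nbhs_normP; exists (realC e); first by rewrite /= realC_gt0.
move=> w /=; rewrite ltCE => /andP[_]; rewrite [re (realC _)]/=; apply: le_lt_trans.
by rewrite -reB abs_re_le.
Qed.
Lemma continuous_im : continuous (@im R : Cplx R -> R).
Proof.
move=> z; apply/(@cvgrPdist_lt _ _ _ (nbhs z)) => e e0.
apply/nbhs_normP; exists (realC e); first by rewrite /= realC_gt0.
move=> w /=; rewrite ltCE => /andP[_]; rewrite [re (realC _)]/=; apply: le_lt_trans.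
by rewrite -imB abs_im_le.
Qed.
Lemma continuous_realC : continuous (@realC R : R -> Cplx R).
Proof.
move=> t; apply/(@cvgrPdist_lt _ _ _ (nbhs t)) => e e0; rewrite (gt0_realC e0).
apply/nbhs_normP; exists (re e); first by move: e0; rewrite ltCE => /andP[].
move=> w /=.
rewrite normCE ltCE /= eqxx /=.
by rewrite /sqabs reB imB /= subrr expr0n /= addr0 sqrtr_sqr.
Qed.
Lemma continuous_conjC : continuous (fun z : Cplx R => z^*).
Proof.
move=> z; apply/(@cvgrPdist_lt _ _ _ (nbhs z)) => e e0.
apply/nbhs_normP; exists e => // w /=.
by rewrite -rmorphB norm_conjC.
Qed.

End ComplexNumbers.

Section RealNorm.
Context {R : realType}.

(** The norm of a complex normed module is a complex number lying on the
    nonnegative half line; estimates are carried out on its real part. *)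
Definition rnorm (V : normedModType (Cplx R)) (v : V) : R := re `|v|.

Context {V : normedModType (Cplx R)}.
Implicit Types u v : V.

Lemma norm_rnorm v : `|v| = realC (rnorm v).
Proof. exact: ge0_realC. Qed.
Lemma rnorm_ge0 v : 0 <= rnorm v.
Proof. by have := normr_ge0 v; rewrite leCE => /andP[]. Qed.
Lemma rnormD u v : rnorm (u + v) <= rnorm u + rnorm v.
Proof. by have := ler_normD u v; rewrite leCE reD => /andP[]. Qed.
Lemma rnormN v : rnorm (- v) = rnorm v. Proof. by rewrite /rnorm normrN. Qed.
Lemma rnorm_distC u v : rnorm (u - v) = rnorm (v - u).
Proof. by rewrite -rnormN opprB. Qed.
Lemma rnorm0 : rnorm (0 : V) = 0. Proof. by rewrite /rnorm normr0. Qed.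
Lemma rnormZ (k : Cplx R) v : rnorm (k *: v) = re `|k| * rnorm v.
Proof. by rewrite /rnorm normrZ reM normCE /= mul0r subr0. Qed.
Lemma rnorm_eq0 v : rnorm v = 0 -> v = 0.
Proof. by move=> h; apply/eqP; rewrite -normr_eq0 norm_rnorm h. Qed.
Lemma rnorm_sqr v : re (`|v| ^+ 2) = rnorm v ^+ 2.
Proof. by rewrite norm_rnorm expr2 -realCM /= expr2. Qed.

Lemma dense_rnorm (S : set V) v (e : R) : dense S -> 0 < e ->
  exists2 w, S w & rnorm (w - v) < e.
Proof.
move=> dS e0.
have e1 : 0 < realC e :> Cplx R by rewrite realC_gt0.
have [||w [bw Sw]] := dS (ball v (realC e : Cplx R)).
- by exists v; apply: ballxx.
- exact: ball_open.
exists w => //; move: bw; rewrite -ball_normE /= ltCE => /andP[_].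
by rewrite -/(rnorm _) rnorm_distC.
Qed.
End RealNorm.

(** * Sums of squares on a dense subspace *)

Section SquareSums.
Context {R : realType}.

Lemma esum_le_fset (I : choiceType) (D : set I) (a : I -> R) (y : R) :
  (\esum_(i in D) (a i)%:E <= y%:E)%E <->
  forall F : {fset I}, [set` F] `<=` D -> \sum_(i <- F) a i <= y.
Proof.
split=> [h F FD|h].
- rewrite -lee_fin; apply: le_trans h; apply: esum_ge.
  exists [set` F]; first by split.
  by rewrite -fsbig_seq ?fset_uniq // sumEFin.
- apply: ge_ereal_sup => _ [F [finF FD] <-].
  rewrite fsbig_finite //= sumEFin lee_fin; apply: h => i /=.
  by rewrite in_fset_set // inE => /FD.
Qed.

(** A sum of nonnegative reals is a supremum of finite subsums, so its upper
    bounds characterise it. *)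
Lemma esum_eq_fset (I : choiceType) (D : set I) (a : I -> R) (x : R) :
  (forall i, 0 <= a i) ->
  (forall F : {fset I}, [set` F] `<=` D -> \sum_(i <- F) a i <= x) ->
  (forall y, (forall F : {fset I}, [set` F] `<=` D -> \sum_(i <- F) a i <= y) ->
    x <= y) ->
  \esum_(i in D) (a i)%:E = x%:E.
Proof.
move=> a0 hle hge; apply/eqP; rewrite eq_le; apply/andP; split.
  exact/esum_le_fset.
have : (0 <= \esum_(i in D) (a i)%:E)%E by apply: esum_ge0 => i _; rewrite lee_fin.
case E: (esum _ _) => [y| |] => [| _|//].
  by rewrite lee_fin => _; apply: hge; have [+ _] := esum_le_fset D a y; apply; rewrite E.
by rewrite leey.
Qed.

Lemma dense_ge (V : topologicalType) (S : set V) (g : V -> R) (v : V) (c : R) :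
  dense S -> {for v, continuous g} -> (forall s, S s -> c <= g s) -> c <= g v.
Proof.
move=> dS gv h; rewrite leNgt; apply/negP => gvc.
have : nbhs v (g @^-1` [set t | t < c]).
  by apply: gv; apply: open_nbhs_nbhs; split => //; exact: open_lt.
rewrite nbhsE => -[U [oU Uv] UP].
have [|s [Us Ss]] := dS U _ oU; first by exists v.
by have := le_lt_trans (h s Ss) (UP s Us); rewrite ltxx.
Qed.

Lemma le_1Dmul (x y : R) : 0 <= y -> (forall t, 0 < t -> x <= (1 + t) * y) -> x <= y.
Proof.
move=> y0 h; apply/ler_addgt0Pr => e e0.
have t0 : 0 < e / (y + 1) by rewrite divr_gt0 // ltr_wpDl.
apply: le_trans (h _ t0) _; rewrite mulrDl mul1r lerD2l.
rewrite mulrAC ler_pdivrMr; last by rewrite ltr_wpDl.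
by rewrite ler_wpM2l ?lerDl // ltW.
Qed.

Lemma continuous_rnorm (V : normedModType (Cplx R)) : continuous (@rnorm R V).
Proof.
move=> v; apply: (@continuous_comp _ _ _ (fun w : V => `|w|) (@re R)).
  exact: norm_continuous.
exact: continuous_re.
Qed.

(** Finite subsums are continuous in the vector, so the Bessel inequality
    passes from the dense set to its closure.  Applied to the difference of two
    vectors, it then bounds what the sum at a vector can lose against the sum at
    a nearby element of the dense set.  No triangle inequality is available for
    the square root of [q]; [sqabsD_le] takes its place. *)
Lemma parseval_dense (V : normedModType (Cplx R)) (I : choiceType) (D : set I)
    (l : I -> V -> Cplx R) (q : V -> R) (S : set V) :
  (forall i, D i -> forall u v, l i (u - v) = l i u - l i v) ->
  (forall i, D i -> exists C, forall v, sqabs (l i v) <= C * rnorm v ^+ 2) ->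
  continuous q -> q 0 = 0 -> dense S ->
  (forall s, S s -> \esum_(i in D) (sqabs (l i s))%:E = (q s)%:E) ->
  forall v, \esum_(i in D) (sqabs (l i v))%:E = (q v)%:E.
Proof.
move=> lB lC cq q0 dS hS v.
have bound (F : {fset I}) : [set` F] `<=` D ->
    exists K, forall w, \sum_(i <- F) sqabs (l i w) <= K * rnorm w ^+ 2.
  move=> FD; have /choice[C hC] (i : I) : exists C, D i ->
      forall w, sqabs (l i w) <= C * rnorm w ^+ 2.
    case: (pselect (D i)) => [/lC[C]|]; first by exists C.
    by exists 0.
  exists (\sum_(i <- F) C i) => w; rewrite mulr_suml big_seq_cond [leRHS]big_seq_cond.
  by apply: ler_sum => i /andP[iF _]; apply: hC; exact: FD.
have sumD (F : {fset I}) u w t : [set` F] `<=` D -> 0 < t ->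
    \sum_(i <- F) sqabs (l i u) <=
    (1 + t) * \sum_(i <- F) sqabs (l i w) + (1 + t^-1) * \sum_(i <- F) sqabs (l i (u - w)).
  move=> FD t0; rewrite !mulr_sumr -big_split /= big_seq_cond [leRHS]big_seq_cond.
  apply: ler_sum => i /andP[/FD Di _]; rewrite lB //.
  by rewrite -{1}(subrKC (l i w) (l i u)); exact: sqabsD_le.
have Ssum s (F : {fset I}) : S s -> [set` F] `<=` D -> \sum_(i <- F) sqabs (l i s) <= q s.
  move=> /hS Ss FD; have [+ _] := esum_le_fset D (fun i => sqabs (l i s)) (q s).
  by apply; rewrite ?Ss.
have cdist (u : V) : continuous (fun s : V => rnorm (u - s)).
  move=> s; apply: (@continuous_comp _ _ _ (fun s : V => u - s) (@rnorm R V)).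
    by apply: continuousB => ? //; exact: cvg_cst.
  exact: continuous_rnorm.
have qS0 s : S s -> 0 <= q s.
  by move=> Ss; have := Ssum s fset0 Ss; rewrite big_seq_fset0; apply.
have q_ge0 u : 0 <= q u.
  by apply: (dense_ge dS) qS0; exact: cq.
have bessel u (F : {fset I}) : [set` F] `<=` D -> \sum_(i <- F) sqabs (l i u) <= q u.
  move=> FD; apply: le_1Dmul => // t t0; have [K hK] := bound F FD.
  pose g s := (1 + t) * q s + (1 + t^-1) * (K * rnorm (u - s) ^+ 2).
  have -> : (1 + t) * q u = g u.
    by rewrite /g subrr rnorm0 expr0n /= !mulr0 addr0.
  apply: (dense_ge dS) => [|s Ss].
    apply: continuousD; apply: continuousM; do ?exact: cvg_cst; first exact: cq.
    apply: continuousM; first exact: cvg_cst.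
    apply: (@continuous_comp _ _ _ (fun s : V => rnorm (u - s)) (fun x : R => x ^+ 2)).
      exact: cdist.
    exact: exprn_continuous.
  apply: le_trans (sumD F u s t FD t0) _.
  have t1 : 0 <= 1 + t^-1 by rewrite addr_ge0 // invr_ge0 ltW.
  by apply: lerD; apply: ler_wpM2l => //; [rewrite addr_ge0 // ltW|exact: Ssum].
apply: esum_eq_fset => [i|F|y hy]; [exact: sqabs_ge0|exact: bessel|].
have y0 : 0 <= y by have := hy fset0; rewrite big_seq_fset0; apply.
apply: le_1Dmul => // t t0.
pose g s := (1 + t) * y + (1 + t^-1) * q (s - v) - q s + q v.
have -> : (1 + t) * y = g v by rewrite /g subrr q0; ring.
apply: (dense_ge dS) => [|s Ss].
  apply: continuousD; last exact: cvg_cst.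
  apply: continuousB; last exact: cq.
  apply: continuousD; first exact: cvg_cst.
  apply: continuousM; first exact: cvg_cst.
  apply: (@continuous_comp _ _ _ (fun s : V => s - v) q); last exact: cq.
  by apply: continuousB => ? //; exact: cvg_cst.
rewrite /g lerDr subr_ge0 -lee_fin -hS //; apply/esum_le_fset => F FD.
apply: le_trans (sumD F s v t FD t0) _.
have t1 : 0 <= 1 + t^-1 by rewrite addr_ge0 // invr_ge0 ltW.
apply: lerD; apply: ler_wpM2l => //; first by rewrite addr_ge0 // ltW.
  exact: hy.
exact: bessel.
Qed.

End SquareSums.

(** * Positive forms *)

Section PositiveForms.
Context {R : realType} {V : lmodType (Cplx R)} (B : V -> V -> Cplx R).
Hypothesis BDr : forall (k : Cplx R) u v w, B u (k *: v + w) = k * B u v + B u w.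
Hypothesis BDl : forall (k : Cplx R) u v w, B (k *: u + v) w = k^* * B u w + B v w.
Hypothesis B_ge0 : forall u, 0 <= B u u.

Lemma form_diagE u : B u u = realC (re (B u u)).
Proof. exact: ge0_realC. Qed.

Lemma re_form_ge0 u : 0 <= re (B u u).
Proof. by have := B_ge0 u; rewrite leCE => /andP[]. Qed.

Lemma form_conj u v : B v u = (B u v)^*.
Proof.
have key (k : Cplx R) : im (k^* * B u v + k * B v u) = 0.
  have := form_diagE (k *: u + v); rewrite BDl !BDr => /(congr1 (@im R)).
  rewrite [X in _ = X]/= [B u u]form_diagE [B v v]form_diagE !(imD, imM, reD, reM).
  by rewrite re_conj im_conj /= => h; rewrite -[RHS]h; ring.
(* The imaginary unit gives the real parts, 1 gives the imaginary parts. *)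
have := key 1; have := key (mkC 0 1).
rewrite !(imD, imM) !re_conj !im_conj re1 im1 /= => h1 h2.
by apply: Cplx_eqP; rewrite ?re_conj ?im_conj; lra.
Qed.

(** Expand the square of [v - t * B u v *: u], with [t] the inverse of [B u u].
    If [B u u] vanishes, the square is affine in [t], so [B u v] vanishes too. *)
Lemma form_CS u v : sqabs (B u v) <= re (B u u) * re (B v v).
Proof.
set a := re (B u u); set c := re (B v v).
have quad (t : R) : 0 <= t ^+ 2 * sqabs (B u v) * a - 2 * t * sqabs (B u v) + c.
  have := re_form_ge0 ((- realC t * B u v) *: u + v).
  rewrite BDl !BDr (form_conj u v) [B u u]form_diagE [B v v]form_diagE -/a -/c.
  rewrite !(reD, reM, imM, re_conj, im_conj, reN, imN, imD) /= /sqabs.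
  by congr (0 <= _); ring.
have := re_form_ge0 u; rewrite -/a le_eqVlt => /predU1P[a0|a0].
  rewrite -a0 mul0r leNgt; apply/negP => s0.
  (* The quadratic is [c - 2 t |B u v|^2]; this [t] gives it the value -1. *)
  have := quad ((c + 1) / (2 * sqabs (B u v))).
  rewrite -a0 mulr0 add0r.
  have -> : 2 * ((c + 1) / (2 * sqabs (B u v))) * sqabs (B u v) = c + 1.
    by field; rewrite gt_eqF.
  by lra.
have := quad a^-1.
have -> : a^-1 ^+ 2 * sqabs (B u v) * a - 2 * a^-1 * sqabs (B u v) + c =
  c - sqabs (B u v) / a by field; rewrite gt_eqF.
by rewrite subr_ge0 ler_pdivrMr // mulrC.
Qed.

(** Write [p m] for the moment [B v (L^m v)] and [N] for [B v v].  By
    Cauchy-Schwarz and symmetry [(p m)^2 <= N * p (2 m)], so if [p 1 > N] then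
    the moments of order [2^n], divided by [N], at least square at each step and
    grow without bound. *)
Lemma form_contraction (L : V -> V) (v : V) (C : R) :
  (forall u w, B (L u) w = B u (L w)) ->
  (forall m, re (B v (iter m L v)) <= C) -> re (B v (L v)) <= re (B v v).
Proof.
move=> Lsym hC; set N := re (B v v).
pose p m := re (B v (iter m L v)).
have iterS m w : B (iter m L v) w = B v (iter m L w).
  elim: m w => //= m IH w; rewrite Lsym IH; congr (B v _).
  by rewrite -iterS iterSr.
have CS m : p m ^+ 2 <= N * p (m + m)%N.
  apply: (@le_trans _ _ (sqabs (B v (iter m L v)))).
    by rewrite /sqabs lerDl sqr_ge0.
  by rewrite /p iterD -(iterS m (iter m L v)); exact: form_CS.
have N0 : 0 <= N := re_form_ge0 v.
rewrite leNgt; apply/negP; rewrite -/(p 1%N) => pN.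
have Npos : 0 < N.
  rewrite lt_neqAle N0 andbT; apply/negP => /eqP N00.
  have := CS 1%N; rewrite -N00 mul0r => h.
  have : 0 < p 1%N ^+ 2 by rewrite exprn_gt0 // N00.
  by rewrite ltNge h.
pose x n := p (2 ^ n)%N / N.
have xS n : x n ^+ 2 <= x n.+1.
  rewrite /x expr_div_n ler_pdivrMr ?exprn_gt0 //.
  have -> : p (2 ^ n.+1)%N / N * N ^+ 2 = N * p (2 ^ n.+1)%N.
    by field; rewrite gt_eqF.
  by rewrite expnS mul2n -addnn; exact: CS.
have x0 : 1 < x 0%N by rewrite /x expn0 ltr_pdivlMr // mul1r.
set d := x 0%N - 1; have d0 : 0 < d by rewrite subr_gt0.
(* Bernoulli's inequality: squaring at least doubles the excess over 1. *)
have xlow n : 1 + n.+1%:R * d <= x n.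
  elim: n => [|n IH]; first by rewrite mul1r /d addrC subrK.
  apply: le_trans (xS n).
  have nd0 : 0 <= n.+1%:R * d by rewrite mulr_ge0 // ltW.
  apply: (@le_trans _ _ ((1 + n.+1%:R * d) ^+ 2)).
    have : d <= n.+1%:R * d by rewrite ler_peMl ?ler1n // ltW.
    rewrite -[n.+2]addn1 natrD; move: nd0; set t := n.+1%:R => nd0.
    have : 0 <= (t * d) ^+ 2 by rewrite sqr_ge0.
    by nra.
  by rewrite lerXn2r // ?nnegrE ?addr_ge0 //; apply: le_trans IH; rewrite addr_ge0.
have [n hn] : exists n, C / (N * d) < n%:R.
  by exists (Num.truncn (C / (N * d))).+1; apply: real_truncnS_gt; exact: num_real.

have : 1 + n.+1%:R * d <= C / N.
  apply: le_trans (xlow n) _; apply: ler_wpM2r; first by rewrite invr_ge0.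
  exact: hC.
apply/negP; rewrite -ltNge.
have -> : C / N = C / (N * d) * d by field; rewrite !gt_eqF.
apply: (@lt_trans _ _ (n%:R * d)); first by rewrite ltr_pM2r.
by rewrite -natr1 mulrDl; lra.
Qed.

End PositiveForms.

(** * C*-algebras, Hilbert modules and states *)

Section CstarAlgebraTheory.
Context {R : realType} {A : cstarAlgebra R}.
Implicit Types (a b c : A) (k : Cplx R).

Lemma cs_mul_addl a b c : cs_mul (a + b) c = cs_mul a c + cs_mul b c.
Proof. by have := cs_mulDl 1 a b c; rewrite !scale1r. Qed.
Lemma cs_mul_addr a b c : cs_mul c (a + b) = cs_mul c a + cs_mul c b.
Proof. by have := cs_mulDr 1 a b c; rewrite !scale1r. Qed.
Lemma cs_mulr0 c : cs_mul c 0 = 0.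
Proof. by apply: (addIr (cs_mul c 0)); rewrite -cs_mul_addr !add0r. Qed.
Lemma cs_mul0r c : cs_mul 0 c = 0.
Proof. by apply: (addIr (cs_mul 0 c)); rewrite -cs_mul_addl !add0r. Qed.
Lemma cs_mulZl k a c : cs_mul (k *: a) c = k *: cs_mul a c.
Proof. by have := cs_mulDl k a 0 c; rewrite cs_mul0r !addr0. Qed.
Lemma cs_mulZr k a c : cs_mul c (k *: a) = k *: cs_mul c a.
Proof. by have := cs_mulDr k a 0 c; rewrite cs_mulr0 !addr0. Qed.
Lemma cs_mulBr a b c : cs_mul c (a - b) = cs_mul c a - cs_mul c b.
Proof. by rewrite cs_mul_addr -scaleN1r cs_mulZr scaleN1r. Qed.
Lemma cs_mulBl a b c : cs_mul (a - b) c = cs_mul a c - cs_mul b c.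
Proof. by rewrite cs_mul_addl -scaleN1r cs_mulZl scaleN1r. Qed.
Lemma cs_star0 : cs_star 0 = 0 :> A.
Proof.
have := @cs_starD R A 1 0 0; rewrite scaler0 addr0 rmorph1 scale1r => h.
by apply: (addIr (cs_star 0)); rewrite -h add0r.
Qed.
Lemma cs_star_add a b : cs_star (a + b) = cs_star a + cs_star b.
Proof. by have := cs_starD 1 a b; rewrite rmorph1 !scale1r. Qed.
Lemma cs_starZ k a : cs_star (k *: a) = k^* *: cs_star a.
Proof. by have := cs_starD k a 0; rewrite cs_star0 !addr0. Qed.
Lemma cs_starB a b : cs_star (a - b) = cs_star a - cs_star b.
Proof. by rewrite cs_star_add -scaleN1r cs_starZ rmorphN rmorph1 scaleN1r. Qed.

Lemma rnorm_mul a b : rnorm (cs_mul a b) <= rnorm a * rnorm b.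
Proof.
by have := cs_normM a b; rewrite !norm_rnorm -realCM realC_le.
Qed.
Lemma rnorm_star_mul a : rnorm (cs_mul (cs_star a) a) = rnorm a ^+ 2.
Proof. by rewrite {1}/rnorm cs_norm_star rnorm_sqr. Qed.
(** The C*-identity gives [|a|^2 <= |a^*| |a|]; exchange [a] and its adjoint. *)
Lemma rnorm_star a : rnorm (cs_star a) = rnorm a.
Proof.
have key b : rnorm b <= rnorm (cs_star b).
  have [b0|b0] := eqVneq (rnorm b) 0; first by rewrite b0 rnorm_ge0.
  have b1 : 0 < rnorm b by rewrite lt_neqAle eq_sym b0 rnorm_ge0.
  by rewrite -(ler_pM2r b1) -expr2 -rnorm_star_mul rnorm_mul.
by apply/eqP; rewrite eq_le key andbT -{2}(cs_starK a) key.
Qed.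

End CstarAlgebraTheory.

Section HilbertModuleTheory.
Context {R : realType} {A : cstarAlgebra R} {E : hilbertModule A}.
Implicit Types (e f g : E) (a b : A) (k : Cplx R).

Lemma hm_ip_addr e f g : hm_ip e (f + g) = hm_ip e f + hm_ip e g.
Proof. by have := hm_ipDr 1 e f g; rewrite !scale1r. Qed.
Lemma hm_ip0r e : hm_ip e 0 = 0.
Proof. by apply: (addIr (hm_ip e 0)); rewrite -hm_ip_addr !add0r. Qed.
Lemma hm_ipZr k e f : hm_ip e (k *: f) = k *: hm_ip e f.
Proof. by have := hm_ipDr k e f 0; rewrite hm_ip0r !addr0. Qed.
Lemma hm_ipBr e f g : hm_ip e (f - g) = hm_ip e f - hm_ip e g.
Proof. by rewrite hm_ip_addr -scaleN1r hm_ipZr scaleN1r. Qed.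
Lemma hm_ipBl e f g : hm_ip (f - g) e = hm_ip f e - hm_ip g e.
Proof. by rewrite -hm_ip_star hm_ipBr cs_starB !hm_ip_star. Qed.
Lemma hm_ipDl k e f g : hm_ip (k *: e + f) g = k^* *: hm_ip e g + hm_ip f g.
Proof. by rewrite -hm_ip_star hm_ipDr cs_starD !hm_ip_star. Qed.
Lemma hm_ipAl e f a : hm_ip (hm_act e a) f = cs_mul (cs_star a) (hm_ip e f).
Proof. by rewrite -hm_ip_star hm_ipA cs_starM hm_ip_star. Qed.
Lemma hm_act_addl e f a : hm_act (e + f) a = hm_act e a + hm_act f a.
Proof. by have := hm_actDl 1 e f a; rewrite !scale1r. Qed.
Lemma hm_act0l a : hm_act (0 : E) a = 0.
Proof. by apply: (addIr (hm_act 0 a)); rewrite -hm_act_addl !add0r. Qed.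
Lemma hm_actZl k e a : hm_act (k *: e) a = k *: hm_act e a.
Proof. by have := hm_actDl k e 0 a; rewrite hm_act0l !addr0. Qed.
Lemma hm_actBl e f a : hm_act (e - f) a = hm_act e a - hm_act f a.
Proof. by rewrite hm_act_addl -scaleN1r hm_actZl scaleN1r. Qed.
Lemma hm_act_addr e a b : hm_act e (a + b) = hm_act e a + hm_act e b.
Proof. by have := hm_actDr 1 e a b; rewrite !scale1r. Qed.
Lemma hm_act0r e : hm_act e 0 = 0.
Proof. by apply: (addIr (hm_act e 0)); rewrite -hm_act_addr !add0r. Qed.

Lemma hm_rnorm e : rnorm e ^+ 2 = rnorm (hm_ip e e).
Proof. by rewrite -rnorm_sqr hm_norm. Qed.
Lemma rnorm_act e a : rnorm (hm_act e a) <= rnorm e * rnorm a.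
Proof.
rewrite -ler_sqr ?nnegrE ?mulr_ge0 ?rnorm_ge0 // hm_rnorm hm_ipA hm_ipAl.
apply: le_trans (rnorm_mul _ _) _.
have -> : (rnorm e * rnorm a) ^+ 2 = rnorm a * rnorm (hm_ip e e) * rnorm a.
  by rewrite -hm_rnorm; ring.
apply: ler_wpM2r; first exact: rnorm_ge0.
by apply: le_trans (rnorm_mul _ _) _; rewrite rnorm_star.
Qed.

End HilbertModuleTheory.

Section HilbertSpaceTheory.
Context {R : realType} {h : hilbertSpace R}.
Implicit Types (u v w : h) (k : Cplx R).

Lemma hs_ipBr u v w : hs_ip u (v - w) = hs_ip u v - hs_ip u w.
Proof. by rewrite addrC -scaleN1r hs_ipDr mulN1r addrC. Qed.
Lemma hs_ipBl u v w : hs_ip (v - w) u = hs_ip v u - hs_ip w u.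
Proof. by rewrite -(hs_ip_conj u) hs_ipBr -(hs_ip_conj u v) -(hs_ip_conj u w) rmorphB. Qed.
Lemma hs_ipDl k u v w : hs_ip (k *: u + v) w = k^* * hs_ip u w + hs_ip v w.
Proof.
rewrite -(hs_ip_conj w) hs_ipDr -(hs_ip_conj w u) -(hs_ip_conj w v).
by rewrite rmorphD rmorphM.
Qed.
Lemma re_hs_norm u : re (hs_ip u u) = rnorm u ^+ 2.
Proof. by rewrite -hs_norm rnorm_sqr. Qed.
Lemma hs_CS u v : sqabs (hs_ip u v) <= rnorm u ^+ 2 * rnorm v ^+ 2.
Proof.
rewrite -!re_hs_norm; apply: form_CS => [k ? ? ?|k ? ? ?|w]; first exact: hs_ipDr.
  exact: hs_ipDl.
by rewrite -hs_norm exprn_ge0.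
Qed.
(** The polarisation which identifies Hilbert space distances with distances of
    square-integrable functions. *)
Lemma re_hs_distE u v : rnorm (u - v) ^+ 2 =
  re (hs_ip u u) + re (hs_ip v v) - 2 * re (hs_ip u v).
Proof.
rewrite -re_hs_norm hs_ipBl !hs_ipBr !reB -(hs_ip_conj u v) re_conj; ring.
Qed.

End HilbertSpaceTheory.

Section States.
Context {R : realType} {A : cstarAlgebra R} (w : A -> Cplx R).
Hypothesis state_w : cs_state w.

Lemma state_lin (k : Cplx R) a b : w (k *: a + b) = k * w a + w b.
Proof. by case: state_w. Qed.
Lemma stateB a b : w (a - b) = w a - w b.
Proof. by rewrite addrC -scaleN1r state_lin mulN1r addrC. Qed.
Lemma stateD a b : w (a + b) = w a + w b.
Proof. by rewrite -{1}[a]scale1r state_lin mul1r. Qed.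
Lemma state0 : w 0 = 0.
Proof. by have := stateB 0 0; rewrite !subrr. Qed.
Lemma state_ge0 a : 0 <= w (cs_mul (cs_star a) a).
Proof. by case: state_w => _ + _ _; apply. Qed.
Lemma re_state_ge0 a : 0 <= re (w (cs_mul (cs_star a) a)).
Proof. by have := state_ge0 a; rewrite leCE => /andP[]. Qed.
Lemma sqabs_state a : sqabs (w a) <= rnorm a ^+ 2.
Proof.
rewrite -re_norm2 lerXn2r ?nnegrE ?rnorm_ge0 //.
case: state_w => _ _ /(_ a) + _.
  by move=> _; have := normr_ge0 (w a); rewrite leCE => /andP[].
case: state_w => _ _ /(_ a) + _.
by rewrite !leCE => /andP[].
Qed.
Lemma re_state_le a : re (w a) <= rnorm a.
Proof.
apply: le_trans (ler_norm _) _; apply: le_trans (abs_re_le _) _.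
by case: state_w => _ _ /(_ a) + _; rewrite leCE => /andP[].
Qed.
Lemma continuous_state : continuous w.
Proof.
move=> a; apply/(@cvgrPdist_lt _ _ _ (nbhs a)) => eps e0.
apply/nbhs_normP; exists eps => // b /= ab; rewrite -stateB.
by apply: le_lt_trans ab; case: state_w.
Qed.

Definition state_form (a b : A) : Cplx R := w (cs_mul (cs_star a) b).
Lemma state_formDr (k : Cplx R) u v x :
  state_form u (k *: v + x) = k * state_form u v + state_form u x.
Proof. by rewrite /state_form cs_mulDr state_lin. Qed.
Lemma state_formDl (k : Cplx R) u v x :
  state_form (k *: u + v) x = k^* * state_form u x + state_form v x.
Proof. by rewrite /state_form cs_starD cs_mulDl state_lin. Qed.

Context {E : hilbertModule A}.

(** Multiplication by [(e | e)] is symmetric for the form [w (a^* b)], and its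
    moments are bounded because [(e | e)] has norm at most 1, so
    [form_contraction] applies. *)
Lemma state_contraction (e : E) (c : A) : rnorm e <= 1 ->
  re (w (cs_mul (cs_star c) (cs_mul (hm_ip e e) c))) <=
  re (w (cs_mul (cs_star c) c)).
Proof.
move=> e1; set a := hm_ip e e.
have a1 : rnorm a <= 1 by rewrite /a -hm_rnorm expr_le1 ?rnorm_ge0.
apply: (form_contraction state_formDr state_formDl state_ge0
  (L := cs_mul a) (C := rnorm c * rnorm c)) => [u v|m].
  by rewrite /state_form cs_starM /a hm_ip_star cs_mulA.
apply: le_trans (re_state_le _) _; apply: le_trans (rnorm_mul _ _) _.
rewrite rnorm_star; apply: ler_wpM2l; first exact: rnorm_ge0.
elim: m => //= m IH; apply: le_trans (rnorm_mul _ _) _.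
by apply: le_trans IH; rewrite ler_piMl ?rnorm_ge0.
Qed.

End States.

(** * Vectors reconstructed by a frame *)

Section RankOneDensity.
Context {R : realType} {A : cstarAlgebra R} {E : hilbertModule A} (w : A -> Cplx R).
Hypothesis state_w : cs_state w.
Hypothesis kadison_w : forall a, sqabs (w a) <= re (w (cs_mul (cs_star a) a)).

(** With [Theta] the positive operator [theta e e], the residual of order [n] is
    [(1 - Theta)^n e]. *)
Let residual (e : E) (n : nat) : E := iter n (fun y => y - theta e e y) e.

(** [Theta] is self-adjoint, so it can be moved from one side to the other. *)
Let residual_ip (e : E) i j :
  hm_ip (residual e i) (residual e j) = hm_ip e (residual e (i + j)%N).
Proof.
elim: i j => // i IH j; rewrite addSnnS -IH /residual /= /theta.
rewrite hm_ipBl hm_ipBr; congr (_ - _).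
by rewrite hm_ipA hm_ipAl hm_ip_star.
Qed.

Let seminorm (y : E) : R := re (w (hm_ip y y)).

Let seminorm_ge0 y : 0 <= seminorm y.
Proof. by rewrite /seminorm; have [b ->] := hm_ip_pos y; exact: re_state_ge0. Qed.

Let coef (e : E) n : A := hm_ip e (residual e n).
Let gain (e : E) n : R := re (w (cs_mul (cs_star (coef e n)) (coef e n))).

Let residual_decrease (e : E) n : rnorm e <= 1 ->
  gain e n <= seminorm (residual e n) - seminorm (residual e n.+1).
Proof.
move=> e1; set y := residual e n; set c := coef e n.
have -> : seminorm (residual e n.+1) = seminorm y - gain e n - gain e n +
    re (w (cs_mul (cs_star c) (cs_mul (hm_ip e e) c))).
  rewrite /seminorm /residual /= -/(residual e n) -/y /theta -/(coef e n) -/c.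
  rewrite hm_ipBl !hm_ipBr !hm_ipA !hm_ipAl -/c.
  have -> : hm_ip y e = cs_star c by rewrite /c /coef hm_ip_star.
  by rewrite !(stateB state_w) !reB /gain -/c -cs_mulA; ring.
have := state_contraction state_w c e1; rewrite -/(gain e n); lra.
Qed.

Let sum_gain (e : E) n : rnorm e <= 1 -> \sum_(i < n) gain e i <= seminorm e.
Proof.
move=> e1; suff : \sum_(i < n) gain e i <= seminorm e - seminorm (residual e n).
  by move=> h; apply: le_trans h _; rewrite gerBl.
elim: n => [|n IH]; first by rewrite big_ord0 /residual /= subrr.
rewrite big_ord_recr /=; have := residual_decrease n e1.
by move: IH; set s := \sum_(i < n) _; rewrite -/(residual e n.+1); lra.
Qed.

Let seminorm_residual (e : E) n :
  seminorm (residual e n) ^+ 2 <= gain e (n + n).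
Proof.
apply: le_trans (kadison_w (coef e (n + n)%N)).
by rewrite /seminorm residual_ip -/(coef e _) /sqabs lerDl sqr_ge0.
Qed.

Let residual_small (e : E) (d : R) : rnorm e <= 1 -> 0 < d ->
  exists n, seminorm (residual e n) < d.
Proof.
move=> e1 d0; apply: contrapT => /forallNP h.
have big n : d ^+ 2 <= gain e (n + n).
  apply: le_trans (seminorm_residual e n).
  rewrite lerXn2r ?nnegrE ?seminorm_ge0 ?(ltW d0) //.
  by rewrite leNgt; exact/negP/h.
have gain0 i : 0 <= gain e i by exact: re_state_ge0.
have low n : n%:R * d ^+ 2 <= seminorm e.
  apply: le_trans (sum_gain (n + n) e1); elim: n => [|n IH].
    by rewrite mul0r big_ord0.
  rewrite addSn addnS !big_ord_recr /= -natr1 mulrDl mul1r -addrA.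
  by apply: lerD IH _; rewrite -[leLHS]addr0 lerD.
have d2 : 0 < d ^+ 2 by rewrite exprn_gt0.
have := low (Num.truncn (seminorm e / d ^+ 2)).+1; rewrite leNgt.
rewrite -ltr_pdivrMr // => /negP; apply; apply: real_truncnS_gt; exact: num_real.
Qed.

(** For [e] in the unit ball, [e - (1 - Theta)^n e] is a combination of vectors
    [theta e e y].  Each step of the iteration lowers the squared seminorm of the
    residual by at least the value of the state on [c^* c], for [c] the
    coefficient [(e | (1 - Theta)^n e)]; these gains are summable and tend to 0.
    The squared seminorm of the n-th residual is the value of the state on the
    coefficient of order [2 n], and Kadison's inequality bounds its square by the
    gain of that order.  So the residuals tend to 0 in the seminorm, and the
    ranges of the rank one operators span a dense subspace. *)
Lemma rank_one_dense (F : set E) :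
  F 0 -> (forall k u v, F u -> F v -> F (k *: u + v)) ->
  (forall u v g, F (theta u v g)) ->
  forall (e : E) (d : R), 0 < d ->
    exists2 f, F f & re (w (hm_ip (e - f) (e - f))) < d.
Proof.
move=> F0 FD Ft.
have unit_ball (e : E) d : rnorm e <= 1 -> 0 < d ->
    exists2 f, F f & seminorm (e - f) < d.
  move=> e1 d0; have [n hn] := residual_small e1 d0.
  exists (e - residual e n); last by rewrite subKr.
  elim: n {hn} => [|n IH]; first by rewrite /residual /= subrr.
  rewrite /residual /= -/(residual e n) opprB addrCA.
  by have := FD 1 _ _ (Ft e e (residual e n)) IH; rewrite scale1r.
(* A general [e] is scaled into the unit ball by [c]; adding 1 keeps [c] from
   vanishing. *)
move=> e d d0; set c := 1 + rnorm e.
have c0 : 0 < c by rewrite ltr_wpDr ?rnorm_ge0.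
have cc : realC c * realC c^-1 = 1 :> Cplx R.
  by rewrite -realCM divff ?gt_eqF.
have [||f Ff hf] := @unit_ball (realC c^-1 *: e) (d / c ^+ 2).
- rewrite rnormZ normCE /= /sqabs /= expr0n /= addr0 sqrtr_sqr.
  rewrite gtr0_norm ?invr_gt0 // mulrC ler_pdivrMr // mul1r /c.
  by rewrite lerDr.
- by rewrite divr_gt0 // exprn_gt0.
exists (realC c *: f); first by rewrite -[_ *: f]addr0; exact: FD.
have -> : e - realC c *: f = realC c *: (realC c^-1 *: e - f).
  by rewrite scalerBr scalerA cc scale1r.
move: hf; set z := _ - f; rewrite /seminorm => hf.
have -> : hm_ip (realC c *: z) (realC c *: z) = realC (c ^+ 2) *: hm_ip z z + 0.
  rewrite hm_ipZr -hm_ip_star hm_ipZr cs_starZ hm_ip_star scalerA addr0.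
  congr (_ *: _); apply: Cplx_eqP; rewrite ?reM ?imM re_conj im_conj /=; ring.
rewrite (state_lin state_w) (state0 state_w) addr0 reM /= mul0r subr0.
by rewrite mulrC -ltr_pdivlMr ?exprn_gt0.
Qed.

End RankOneDensity.

Section FrameSums.
Context {R : realType} {A : cstarAlgebra R} {E : hilbertModule A}.
Context {J : countType} (e_ : J -> E).

Definition frame_sum (B : {fset J}) (f : E) : E :=
  \sum_(j <- B) theta (e_ j) (e_ j) f.

Lemma frame_sum_lin B (k : Cplx R) f g :
  frame_sum B (k *: f + g) = k *: frame_sum B f + frame_sum B g.
Proof.
rewrite /frame_sum scaler_sumr -big_split /=; apply: eq_bigr => j _.
by rewrite /theta hm_ipDr hm_actDr.
Qed.

Definition reconstructed : set E := [set f | forall d : R, 0 < d ->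
  exists B0 : {fset J}, forall B : {fset J}, (B0 `<=` B)%fset ->
    rnorm (frame_sum B f - f) < d].

Lemma reconstructed0 : reconstructed 0.
Proof.
move=> d d0; exists fset0 => B _.
by rewrite /frame_sum big1 ?subrr ?rnorm0 // => j _; rewrite /theta hm_ip0r hm_act0r.
Qed.

Lemma reconstructed_lin (k : Cplx R) f g :
  reconstructed f -> reconstructed g -> reconstructed (k *: f + g).
Proof.
move=> hf hg d d0; set c := 1 + re `|k|.
have k0 : 0 <= re `|k| := rnorm_ge0 (k : Cplx R).
have c0 : 0 < c by rewrite ltr_wpDr.
have [|B1 h1] := hf (d / 2 / c); first by rewrite !divr_gt0.
have [|B2 h2] := hg (d / 2); first by rewrite divr_gt0.
exists (B1 `|` B2)%fset => B; rewrite fsubUset => /andP[/h1 fB /h2 gB].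
rewrite frame_sum_lin opprD addrACA -scalerBr.
apply: le_lt_trans (rnormD _ _) _; rewrite rnormZ [ltRHS]splitr.
apply: ler_ltD gB; apply: (@le_trans _ _ (c * rnorm (frame_sum B f - f))).
  by rewrite ler_wpM2r ?rnorm_ge0 // /c lerDr.
by rewrite mulrC -ler_pdivlMr // ltW.
Qed.

(** Strict convergence tests the partial sums against compact operators, of which
    [theta u v] is one. *)
Lemma reconstructed_theta (u v g : E) :
  module_frame e_ -> reconstructed (theta u v g).
Proof.
move=> fr d d0; set c := 1 + rnorm g.
have c0 : 0 < c by rewrite ltr_wpDr ?rnorm_ge0.
have K : compact_operator (theta u v).
  move=> eps e0; exists (theta u v); last first.
    by move=> f; rewrite subrr normr0 mulr_ge0 // ltW.
  by exists 1%N, (fun=> u), (fun=> v) => f; rewrite big_ord1.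
have [|B0 _ hB] := fr _ K (realC (d / c)); first by rewrite realC_gt0 divr_gt0.
exists B0 => B B0B; have [+ _] := hB B B0B g.
rewrite norm_rnorm (norm_rnorm g) -realCM realC_le => h.
apply: le_lt_trans h _; rewrite mulrAC ltr_pdivrMr //.
by rewrite ltr_pM2l // /c ltrDr.
Qed.

End FrameSums.

(** * Sums over the fibres of an etale range map *)

Section WithinFilters.

Lemma near_withinI {T : topologicalType} (Y : set T) (P : T -> Prop) (y0 : T) :
  Y y0 -> (\forall y \near within Y (nbhs y0), P y) -> P y0.
Proof. by move=> Yy0 /nbhs_singleton; apply. Qed.

Lemma near_all_seq {T : Type} {I : eqType} (F : set_system T) (Ff : Filter F)
    (l : seq I) (P : I -> T -> Prop) :
  (forall i, i \in l -> \forall t \near F, P i t) ->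
  \forall t \near F, forall i, i \in l -> P i t.
Proof.
elim: l => [|i l IH] h; first by apply: nearW.
have h1 := h i (mem_head _ _).
have h2 : \forall t \near F, forall j, j \in l -> P j t.
  by apply: IH => j jl; apply: h; rewrite inE jl orbT.
near=> t => j; rewrite inE => /predU1P[->|]; first by near: t.
by move: j; near: t.
Unshelve. all: by end_near. Qed.

Lemma cvg_sum_seq {K : numFieldType} {V : normedModType K} {T : Type} {I : eqType}
    (F : set_system T) (Ff : Filter F) (l : seq I) (f : I -> T -> V) (a : I -> V) :
  (forall i, i \in l -> f i @ F --> a i) ->
  (fun t => \sum_(i <- l) f i t) @ F --> \sum_(i <- l) a i.
Proof.
elim: l => [|i l IH] fa.
  by rewrite big_nil; under eq_fun do rewrite big_nil; exact: cvg_cst.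
rewrite big_cons; under eq_fun do rewrite big_cons.
apply: cvgD; first by apply: fa; rewrite mem_head.
by apply: IH => j jl; apply: fa; rewrite inE jl orbT.
Qed.

Lemma cvg_withinr {T : Type} {U : topologicalType} (F : set_system T)
    (Ff : Filter F) (f : T -> U) (D : set U) (u : U) :
  f @ F --> u -> (\forall t \near F, D (f t)) -> f @ F --> within D (nbhs u).
Proof.
move=> fu fD N Nu; have := fu _ Nu; apply: filterS2 fD => t Dt; exact.
Qed.

End WithinFilters.

Section FibreSums.
Context {R : realType} {G : ptopologicalType} (Gd : groupoid G) (X : set G).
Hypothesis Gtop : topological_groupoid Gd.
Hypothesis GT2 : hausdorff_space G.
Hypothesis Het : etale_HX Gd X.
Local Notation r := (gr Gd).
Local Notation s := (gs Gd).
Local Notation H := (HX Gd X).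

Lemma closed_point (x : G) : closed [set x].
Proof. exact/accessible_closed_set1/hausdorff_accessible. Qed.

(** The fibre of [r] inside a compact set is compact and, because bisections are
    injective for [r], discrete. *)
Lemma finite_fibre (K : set G) (x0 : G) : compact K -> K `<=` H ->
  finite_set (K `&` [set z | r z = x0]).
Proof.
move=> cK KH; set F := _ `&` _.
have cF : compact F.
  apply: compact_closedI => //.
  have -> : [set z | r z = x0] = r @^-1` [set x0] by [].
  by apply: closed_comp => [z _|]; [exact: tg_r|exact: closed_point].
have /choice[U hU] (z : G) : exists U : set G, H z ->
    [/\ open U, U z & set_inj (U `&` H) r].
  case: (pselect (H z)) => [/Het[U [? ? ? _]]|]; first by exists U.
  by exists set0.
have FH z : F z -> H z by case=> /KH.
move: cF; rewrite compact_cover => /(_ G F U).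
case=> [z /FH/hU[] //|z Fz|D' D'F FD'].
  by exists z => //; have [] := hU _ (FH _ Fz).
apply: (sub_finite_set _ (finite_fset D')) => z Fz /=.
have [z' D'z' Uz] := FD' _ Fz.
have Fz' : F z' by move: (D'F _ D'z'); rewrite inE.
have [_ Uz' inj] := hU _ (FH _ Fz').
suff -> : z = z' by [].
by apply: inj; rewrite ?inE; [split => //; exact: FH..|rewrite Fz.2 Fz'.2].
Qed.

Section LocalSection.
Context (Y : set G) (p : G -> G) (y0 z0 : G) (U : set G).
Hypothesis pY : p @ within Y (nbhs y0) --> p y0.
Hypothesis pX : forall y, Y y -> X (p y).
Hypothesis Hz0 : H z0.
Hypothesis rz0 : r z0 = p y0.
Hypothesis U_inj : set_inj (U `&` H) r.
Hypothesis U_open : forall V, open V ->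
  exists2 W, open W & r @` (V `&` (U `&` H)) = W `&` X.
Hypothesis Uz0 : U z0.
Hypothesis Yy0 : Y y0.

(** The local inverse of [r] on the bisection [U], read along [p].  Near
    [y0] the set selected from is a singleton. *)
Definition local_section (y : G) : G := xget z0 [set z | [/\ U z, H z & r z = p y]].

Lemma local_section_uniq (y z : G) : U z -> H z -> r z = p y -> local_section y = z.
Proof.
move=> Uz Hz rz; rewrite /local_section; case: xgetP => [z' _ [Uz' Hz' rz']|/(_ z)].
  by apply: U_inj; rewrite ?inE // rz' rz.
by case; split.
Qed.

Lemma near_local_section (V : set G) : open V -> V z0 ->
  \forall y \near within Y (nbhs y0), [/\ V (local_section y), U (local_section y),
    H (local_section y) & r (local_section y) = p y].
Proof.
move=> oV Vz0; have [W oW eW] := U_open oV.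
have Wp : W (p y0).
  suff : (W `&` X) (p y0) by case.
  by rewrite -eW -rz0; exists z0.
have hW : \forall y \near within Y (nbhs y0), W (p y).
  by apply: pY; exact: open_nbhs_nbhs.
have hY : \forall y \near within Y (nbhs y0), Y y by exact: withinT.
near=> y.
have : (W `&` X) (p y) by split; [near: y|apply: pX; near: y].
rewrite -eW => -[z [Vz [Uz Hz]] rz].
by rewrite (local_section_uniq Uz Hz rz).
Unshelve. all: by end_near. Qed.

End LocalSection.

(** Near a given point, the part of the fibre of the etale range map lying in
    a compact set is the disjoint union of the values of finitely many local
    sections, so the sum is locally a finite sum of continuous functions. *)
Lemma fibre_sum_continuous (Y : set G) (p : G -> G) (K : set G)
    (Phi : G * G -> Cplx R) :
  {within Y, continuous p} -> (forall y, Y y -> X (p y)) ->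
  compact K -> K `<=` H ->
  (forall y z, Y y -> H z -> r z = p y -> ~ K z -> Phi (y, z) = 0) ->
  {within [set q : G * G | [/\ Y q.1, H q.2 & r q.2 = p q.1]], continuous Phi} ->
  {within Y, continuous (fun y => \sum_(z \in [set z | H z /\ r z = p y]) Phi (y, z))}.
Proof.
move=> pc pX cK KH PhiK /subspace_continuousP Phic.
apply/subspace_continuousP => y0 Yy0.
have {}pc : p @ within Y (nbhs y0) --> p y0 by move/subspace_continuousP : pc; apply.
set F := K `&` [set z | r z = p y0].
have finF : finite_set F by exact: finite_fibre.
have FH z : F z -> H z by case=> /KH.
have /choice[U hU] (z : G) : exists U : set G, F z -> [/\ open U, U z,
    set_inj (U `&` H) r & forall V, open V ->
    exists2 W, open W & r @` (V `&` (U `&` H)) = W `&` X].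
  by case: (pselect (F z)) => [/FH/Het[V hV]|]; [exists V|exists set0].
pose ze z := local_section p z (U z).
have ze_near z V : F z -> open V -> V z -> \forall y \near within Y (nbhs y0),
    [/\ V (ze z y), U z (ze z y), H (ze z y) & r (ze z y) = p y].
  move=> Fz oV Vz; have [oU Uz Uinj Uo] := hU _ Fz.
  by apply: near_local_section => //; [exact: FH|exact: Fz.2].
have ze_uniq z y z' : F z -> U z z' -> H z' -> r z' = p y -> ze z y = z'.
  by move=> Fz; have [_ _ Ui _] := hU _ Fz; exact: local_section_uniq.
(* The part of [K] outside the chosen bisections misses the fibre over [p y0],
   hence, being compact, also the nearby fibres. *)
pose C := K `&` ~` (\bigcup_(z in F) U z).
have cC : compact C.
  apply: compact_closedI => //; apply: open_closedC; apply: bigcup_open => z Fz.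
  by have [] := hU _ Fz.
have Cnear : \forall y \near within Y (nbhs y0), forall z, C z -> r z <> p y.
  have cl : closed (r @` C).
    apply: compact_closed => //; apply: continuous_compact => //.
    by apply: continuous_subspaceT => z; exact: tg_r.
  have : \forall y \near within Y (nbhs y0), (~` (r @` C)) (p y).
    apply: (pc (~` (r @` C))); apply: open_nbhs_nbhs; split; first exact: closed_openC.
    move=> [z [Kz Uz] rz]; apply: Uz; have Fz : F z by split.
    by exists z => //; have [] := hU _ Fz.
  by apply: filterS => y h z Cz rz; apply: h; exists z.
have hY : \forall y \near within Y (nbhs y0), Y y by exact: withinT.
pose l : seq G := fset_set F.
have lF z : z \in l -> F z by rewrite in_fset_set // inE.
have Fl z : F z -> z \in l by rewrite in_fset_set // inE.
have zeN : \forall y \near within Y (nbhs y0), forall z, z \in l ->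
    [/\ U z (ze z y), H (ze z y) & r (ze z y) = p y].
  apply: near_all_seq => z /lF Fz; have := ze_near z setT Fz openT I.
  by apply: filterS => y [].
have injN : \forall y \near within Y (nbhs y0), forall z, z \in l ->
    forall z', z' \in l -> z != z' -> ze z y != ze z' y.
  apply: near_all_seq => z /lF Fz; apply: near_all_seq => z' /lF Fz'.
  have [->|zz'] := eqVneq z z'; first by apply: nearW => y.
  move: GT2; rewrite open_hausdorff => /(_ z z' zz')[[V V'] /= [+ +] [oV oV' VV']].
  rewrite !inE => Vz V'z'.
  have := ze_near z V Fz oV Vz; have := ze_near z' V' Fz' oV' V'z'.
  apply: filterS2 => y [h1 _ _ _] [h2 _ _ _] _; apply/eqP => e.
  by move/eqP : VV'; apply/eqP/set0P; exists (ze z y); split => //; rewrite e.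
have sumE : \forall y \near within Y (nbhs y0),
    \sum_(z \in [set z | H z /\ r z = p y]) Phi (y, z) = \sum_(z <- l) Phi (y, ze z y).
  near=> y.
  have Yy : Y y by near: y.
  have zey : forall z, z \in l -> [/\ U z (ze z y), H (ze z y) & r (ze z y) = p y].
    by near: y.
  have injy : forall z, z \in l -> forall z', z' \in l -> z != z' -> ze z y != ze z' y.
    by near: y.
  have Cy : forall z, C z -> r z <> p y by near: y.
  transitivity (\sum_(z \in (ze^~ y) @` F) Phi (y, z)).
    apply/esym/fsbig_widen => [_ [z /Fl/zey[_ Hz rz] <-] //|z [[Hz rz] nz]].
    apply: PhiK => // Kz; apply: (Cy z) => //; split => // -[z' Fz' Uz].
    by apply: nz; exists z' => //; exact: ze_uniq.
  rewrite fsbig_image ?fsbig_finite // => z z' /[!inE] Fz Fz' e.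
  apply: contrapT => /eqP zz'.
  by have := injy _ (Fl _ Fz) _ (Fl _ Fz') zz'; rewrite e eqxx.
rewrite [X in _ --> X](near_withinI Yy0 sumE).
have e : {near within Y (nbhs y0), (fun y => \sum_(z <- l) Phi (y, ze z y)) =1
    (fun y => \sum_(z \in [set z | H z /\ r z = p y]) Phi (y, z))}.
  by move: sumE; apply: filterS => y ->.
apply: cvg_trans (near_eq_cvg e) _.
apply: cvg_sum_seq => z /lF Fz.
have zz : ze z y0 = z.
  by apply: ze_uniq => //; [have [] := hU _ Fz|exact: FH|exact: Fz.2].
have cze : ze z @ within Y (nbhs y0) --> z.
  move=> N Nz; have : nbhs z N by []; rewrite (nbhsE z) => -[V [oV Vz] VN].
  by have := ze_near z V Fz oV Vz; apply: filterS => y [/VN].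
have zP : [set q : G * G | [/\ Y q.1, H q.2 & r q.2 = p q.1]] (y0, ze z y0).
  by rewrite /= zz; split => //; [exact: FH|exact: Fz.2].
apply: (cvg_comp _ _ _ (Phic _ zP)); apply: cvg_withinr.
  by rewrite zz; apply: cvg_pair; [exact: cvg_within|exact: cze].
have := ze_near z setT Fz openT I; apply: filterS2 hY => y Yy [_ _ Hz rz].
by split.
Unshelve. all: by end_near. Qed.

End FibreSums.

(** * Compactly supported functions on the groupoid *)

Section WithinContinuity.
Context {T U V : topologicalType}.

Lemma within_comp (D : set T) (E : set U) (f : T -> U) (g : U -> V) :
  {within D, continuous f} -> {within E, continuous g} ->
  (forall x, D x -> E (f x)) -> {within D, continuous (fun x => g (f x))}.
Proof.
move=> /subspace_continuousP cf /subspace_continuousP cg DE.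
apply/subspace_continuousP => x Dx.
apply: (cvg_comp _ _ _ (cg _ (DE _ Dx))); apply: cvg_withinr; first exact: cf.
have : \forall y \near within D (nbhs x), D y by exact: withinT.
by apply: filterS => y /DE.
Qed.

Lemma within_pair (D : set T) (f : T -> U) (g : T -> V) :
  {within D, continuous f} -> {within D, continuous g} ->
  {within D, continuous (fun x => (f x, g x))}.
Proof.
move=> /subspace_continuousP cf /subspace_continuousP cg.
by apply/subspace_continuousP => x Dx; apply: cvg_pair; [exact: cf|exact: cg].
Qed.

Lemma within_eq (D : set T) (f g : T -> U) : (forall x, D x -> f x = g x) ->
  {within D, continuous f} -> {within D, continuous g}.
Proof.
by move=> fg; apply: subspace_eq_continuous => x /[!inE]; exact: fg.
Qed.
End WithinContinuity.

Lemma within_mulC {R : realType} {T : topologicalType} (D : set T) (f g : T -> Cplx R) :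
  {within D, continuous f} -> {within D, continuous g} ->
  {within D, continuous (fun x => f x * g x)}.
Proof.
move=> /subspace_continuousP cf /subspace_continuousP cg.
by apply/subspace_continuousP => x Dx; apply: cvgM; [exact: cf|exact: cg].
Qed.

(** A locally compact Hausdorff space is completely regular: separate [x] from
    the complement of a neighbourhood with compact closure inside [U]. *)
Lemma bump_function (R : realType) (G : topologicalType) (U : set G) (x : G) :
  locally_compact [set: G] -> hausdorff_space G -> open U -> U x ->
  exists2 f : G -> R, continuous f & [/\ forall y, 0 <= f y <= 1, f x = 1 &
    exists K, [/\ compact K, K `<=` U & forall y, ~ K y -> f y = 0]].
Proof.
move=> lc T2 oU Ux.
have [W Wx [cW clW]] := lc x I.
have cr : completely_regular_space G by exact: (@locally_compact_completely_regular G R).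
have reg := @completely_regular_regular R G cr.
have Ux' : nbhs x U by exact: open_nbhs_nbhs.
have Wx' : nbhs x W by move: Wx; rewrite withinET.
have [B Bx clB] := reg x _ (filterI Ux' Wx').
have oB : closed (~` B°) by apply: open_closedC; exact: open_interior.
have nB : ~ (~` B°) x by move=> /(_ Bx).
have /(@uniform_separatorP G R)[f [cf f01 f0 f1]] := cr x _ oB nB.
exists (fun y => 1 - f y).
  by move=> y; apply: cvgB; [exact: cvg_cst|exact: cf].
split.
- move=> y; have : range f (f y) by exists y.
  by move/f01 => /=; rewrite in_itv /= subr_ge0 gerBl => /andP[-> ->].
- have -> : f x = 0 by apply: f0; exists x.
  by rewrite subr0.
- exists (closure B); split.
  + apply: (subclosed_compact _ cW); first exact: closed_closure.
    by move=> y /clB[].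
  + by move=> y /clB[].
  + move=> y nBy; have -> : f y = 1; last by rewrite subrr.
    apply: f1; exists y => // By; apply: nBy; apply: subset_closure.
    exact: interior_subset.
Qed.

Section ConvolutionAlgebra.
Context {R : realType} {G : ptopologicalType} (Gd : groupoid G) (X : set G).
Hypothesis Gtop : topological_groupoid Gd.
Hypothesis Glc : locally_compact [set: G].
Hypothesis GT2 : hausdorff_space G.
Hypothesis Xtr : compact_transversal Gd X.
Hypothesis Het : etale_HX Gd X.
Context (sigma : G -> G -> Cplx R).
Hypothesis sigma_coc : normalised_cocycle Gd sigma.
Local Notation r := (gr Gd).
Local Notation s := (gs Gd).
Local Notation inv := (ginv Gd).
Local Notation mul := (gmul Gd).
Local Notation H := (HX Gd X).
Local Notation Cx := (composable Gd).

Lemma g_invK g : inv (inv g) = g.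
Proof.
have sr : s (inv g) = r g by rewrite g_sV.
have vr : r (inv g) = s g by rewrite g_rV.
have vvr : r (inv (inv g)) = r g by rewrite g_rV.
rewrite -[RHS](g_mulg1 Gd) -vr -(g_mulgV Gd (inv g)) -g_mulA // ?vvr //.
by rewrite g_mulgV -vvr g_mul1g.
Qed.

Lemma g_mulKV g h : r g = r h -> mul g (mul (inv g) h) = h.
Proof.
move=> e; rewrite -g_mulA ?g_rV ?g_sV // g_mulgV e; exact: g_mul1g.
Qed.

Lemma g_mulVK g h : s g = r h -> mul (inv g) (mul g h) = h.
Proof.
by move=> e; rewrite -g_mulA ?g_sV // g_mulVg e; exact: g_mul1g.
Qed.

Lemma g_mulK g h : s g = r h -> mul (mul g h) (inv h) = g.
Proof.
by move=> e; rewrite g_mulA ?g_rV // g_mulgV -e g_mulg1.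
Qed.

Lemma g_invM g h : s g = r h -> inv (mul g h) = mul (inv h) (inv g).
Proof.
move=> e; set k := mul (inv h) (inv g).
have c1 : s (inv h) = r (inv g) by rewrite g_sV g_rV e.
have km : mul k (mul g h) = s (mul g h).
  by rewrite /k g_mulA // ?g_sV ?g_rM // g_mulVK // g_mulVg g_sM.
rewrite -[RHS](@g_mulK k (mul g h)); last by rewrite /k g_sM // g_sV g_rM.
by rewrite km -g_rV g_mul1g.
Qed.

Lemma HX_inv g : H g -> H (inv g).
Proof. by case=> Xs Xr; split; rewrite ?g_sV ?g_rV. Qed.

Lemma closed_HX : closed H.
Proof.
have -> : H = s @^-1` X `&` r @^-1` X by [].
have Xc := tr_closed Xtr.
by apply: closedI; apply: closed_comp => // z _; [exact: tg_s|exact: tg_r].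
Qed.

Lemma closed_composable : closed Cx.
Proof.
have c2 : continuous (fun q : G * G => (s q.1, r q.2)).
  move=> q; apply: cvg_pair => /=.
    by apply: cvg_comp; [exact: cvg_fst|exact: (tg_s Gtop)].
  by apply: cvg_comp; [exact: cvg_snd|exact: (tg_r Gtop)].
have dcl : closed [set q : G * G | q.1 = q.2].
  rewrite closure_id; apply/seteqP; split; first exact: subset_closure.
  move=> [a b] hab /=; apply: GT2 => N M Na Mb.
  have [|[c d] /= [-> [Nc Md]]] := hab (N `*` M); first by exists (N, M).
  by exists d.
have -> : Cx = (fun q : G * G => (s q.1, r q.2)) @^-1` [set q | q.1 = q.2] by [].
by apply: closed_comp => // q _; exact: c2.
Qed.

Definition mul_set (K L : set G) : set G :=
  (fun q : G * G => mul q.1 q.2) @` (Cx `&` (K `*` L)).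

Lemma compact_mul_set K L : compact K -> compact L -> compact (mul_set K L).
Proof.
move=> cK cL; apply: continuous_compact.
  by apply: (continuous_subspaceW _ (tg_mul Gtop)) => q [].
rewrite setIC; apply: compact_closedI; last exact: closed_composable.
exact: compact_setX.
Qed.

(** A term of the convolution at [y] is nonzero only if [y] is a product of
    elements of the two supports, which form a compact set; continuity is an
    instance of [fibre_sum_continuous]. *)
Lemma Cc_conv f1 f2 : Cc H f1 -> Cc H f2 -> Cc H (Defs.conv Gd X sigma f1 f2).
Proof.
move=> [c1 [K [cK KH K0]]] [c2 [L [cL LH L0]]]; split; last first.
  exists (mul_set K L); split; first exact: compact_mul_set.
  - move=> _ [[g h] /= [e [/KH[? ?] /LH[? ?]]] <-].
    by split; rewrite ?g_sM ?g_rM.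
  - move=> y ny; rewrite /Defs.conv fsbig1 // => z /= [Hz rz].
    have [Kz|/K0->] := pselect (K z); last by rewrite !mul0r.
    have [Lz|/L0->] := pselect (L (mul (inv z) y)); last by rewrite mulr0 mul0r.
    case: ny; exists (z, mul (inv z) y); rewrite /= ?g_mulKV //; split => //.
    by rewrite /composable /= g_rM ?g_rV ?g_sV.
pose P := [set q : G * G | [/\ H q.1, H q.2 & r q.2 = r q.1]].
have cfst : {within P, continuous fst} by apply: continuous_subspaceT => q; exact: cvg_fst.
have csnd : {within P, continuous snd} by apply: continuous_subspaceT => q; exact: cvg_snd.
have cq : {within P, continuous (fun q : G * G => mul (inv q.2) q.1)}.
  apply: (@within_comp _ _ _ P Cx (fun q : G * G => (inv q.2, q.1)) (fun q => mul q.1 q.2)).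
  - apply: within_pair cfst; apply: (@within_comp _ _ _ P setT snd inv) => //.
    by apply: continuous_subspaceT; exact: tg_inv.
  - exact: tg_mul.
  - by move=> q [? ? e]; rewrite /composable /= g_sV.
apply: (fibre_sum_continuous Gtop GT2 Het (K := K)
  (Phi := fun q => f1 q.2 * f2 (mul (inv q.2) q.1) * sigma q.2 (mul (inv q.2) q.1))) => //.
- by apply: continuous_subspaceT; exact: tg_r.
- by move=> y [].
- by move=> y z _ _ _ /K0 /= ->; rewrite !mul0r.
- apply: within_mulC; first apply: within_mulC.
  + by apply: within_comp c1 _ => // q [].
  + apply: within_comp c2 _ => // q [[? ?] [? ?] e].
    by split; rewrite ?g_sM ?g_rM ?g_rV ?g_sV.
  + apply: (@within_comp _ _ _ P Cx (fun q : G * G => (q.2, mul (inv q.2) q.1))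
      (fun q => sigma q.1 q.2)).
    * exact: within_pair.
    * exact: coc_continuous.
    * by move=> q [? ? e]; rewrite /composable /= g_rM ?g_rV ?g_sV.
Qed.

Lemma Cc_invol (f : G -> Cplx R) : Cc H f -> Cc H (invol Gd f).
Proof.
move=> [cf [K [cK KH K0]]]; split.
  have cfi : {within H, continuous (fun g => f (inv g))}.
    apply: within_comp cf _; last exact: HX_inv.
    by apply: continuous_subspaceT; exact: tg_inv.
  move/subspace_continuousP : cfi => cfi; apply/subspace_continuousP => g Hg.
  rewrite /invol; apply: (cvg_comp (fun g => f (inv g)) (fun z : Cplx R => z^*) (cfi g Hg)).
  exact: continuous_conjC.
exists (inv @` K); split.
- apply: continuous_compact => //.
  by apply: continuous_subspaceT; exact: tg_inv.
- by move=> _ [g /KH Hg <-]; exact: HX_inv.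
- move=> g ng; rewrite /invol K0 ?rmorph0 // => Kg; apply: ng.
  by exists (inv g) => //; rewrite g_invK.
Qed.

Lemma Cc_right_action e f : Cc (GX Gd X) e -> Cc H f ->
  Cc (GX Gd X) (right_action Gd X sigma e f).
Proof.
move=> [c1 [K [cK KH K0]]] [c2 [L [cL LH L0]]]; split; last first.
  exists (mul_set K L); split; first exact: compact_mul_set.
  - by move=> _ [[g h] /= [e' [_ /LH[? ?]]] <-]; rewrite /GX /= g_sM.
  - move=> y ny; rewrite /right_action fsbig1 // => z /= [Hz rz].
    have [Kz|/K0->] := pselect (K (mul y z)); last by rewrite !mul0r.
    have [Lz|/L0->] := pselect (L (inv z)); last by rewrite mulr0 mul0r.
    case: ny; exists (mul y z, inv z); rewrite /= ?g_mulK //; split => //.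
    by rewrite /composable /= g_sM // g_rV.
pose P := [set q : G * G | [/\ GX Gd X q.1, H q.2 & r q.2 = s q.1]].
have cfst : {within P, continuous fst} by apply: continuous_subspaceT => q; exact: cvg_fst.
have csnd : {within P, continuous snd} by apply: continuous_subspaceT => q; exact: cvg_snd.
have cinv : {within P, continuous (fun q : G * G => inv q.2)}.
  apply: (@within_comp _ _ _ P setT snd inv) => //.
  by apply: continuous_subspaceT; exact: tg_inv.
have cq : {within P, continuous (fun q : G * G => mul q.1 q.2)}.
  by apply: (continuous_subspaceW _ (tg_mul Gtop)) => q [].
apply: (fibre_sum_continuous Gtop GT2 Het (K := inv @` L)
  (Phi := fun q => e (mul q.1 q.2) * f (inv q.2) * sigma (mul q.1 q.2) (inv q.2))) => //.
- by apply: continuous_subspaceT; exact: tg_s.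
- apply: continuous_compact => //.
  by apply: continuous_subspaceT; exact: tg_inv.
- by move=> _ [g /LH Hg <-]; exact: HX_inv.
- move=> y z _ _ _ nz; rewrite /= (L0 (inv z)) ?mulr0 ?mul0r // => Lz; apply: nz.
  by exists (inv z) => //; rewrite g_invK.
- apply: within_mulC; first apply: within_mulC.
  + by apply: within_comp c1 _ => // q [? [? ?] ?]; rewrite /GX /= g_sM.
  + by apply: within_comp c2 _ => // q [_ /HX_inv].
  + apply: (@within_comp _ _ _ P Cx (fun q : G * G => (mul q.1 q.2, inv q.2))
      (fun q => sigma q.1 q.2)).
    * exact: within_pair.
    * exact: coc_continuous.
    * by move=> q [? ? e']; rewrite /composable /= g_sM // g_rV.
Qed.

(** A function supported in a bisection around [beta] restricts to the point
    mass at [beta] on the fibre of [s] through [beta]. *)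
Lemma point_mass (beta : G) : H beta -> exists2 b : G -> Cplx R, Cc H b &
  b beta = 1 /\ forall g, H g -> s g = s beta -> g <> beta -> b g = 0.
Proof.
move=> Hb; have [U [oU Ub Ui _]] := Het (HX_inv Hb).
have [||f cf [_ f1 [K [cK KU K0]]]] :=
  @bump_function R G (inv @^-1` U) beta Glc GT2.
- by apply: open_comp => // z _; exact: tg_inv.
- exact: Ub.
exists (fun g => if g \in H then realC (f g) else 0); last split.
- split.
    apply: (@within_eq _ _ H (fun g => realC (f g))) => [g Hg|]; first by rewrite mem_set.
    apply: continuous_subspaceT => g.
    by apply: continuous_comp; [exact: cf|exact: continuous_realC].
  exists (K `&` H); split; [exact: compact_closedI closed_HX|by move=> g []|].
  move=> g nKH; case: ifPn => // /[!inE] Hg; rewrite K0 // => Kg; exact: nKH.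
- by rewrite mem_set // f1.
- move=> g Hg sg gb; rewrite mem_set // K0 // => /KU /= Ug; apply: gb.
  rewrite -(g_invK g) -(g_invK beta); congr inv.
  by apply: Ui; rewrite ?inE ?g_rV //; split => //; exact: HX_inv.
Qed.

(** At a unit the cocycle factors are [sigma z z^-1], which are 1. *)
Lemma conv_unit f1 f2 x : X x ->
  Defs.conv Gd X sigma f1 f2 x = \sum_(z \in [set z | H z /\ r z = x]) f1 z * f2 (inv z).
Proof.
move=> Xx; have rx : r x = x := tr_units Xtr Xx.
rewrite /Defs.conv rx; apply: eq_fsbigr => z /[!inE] -[_ rz].
have -> : mul (inv z) x = inv z by rewrite -rz -(g_sV Gd z) g_mulg1.
by rewrite coc_inv // mulr1.
Qed.

End ConvolutionAlgebra.

(** * The evaluation state at a unit *)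

Section NormContinuity.
Context {R : realType}.

Lemma continuous_rnorm_bound (V W : normedModType (Cplx R)) (g : V -> W)
    (bnd : V -> R) (v : V) :
  {for v, continuous bnd} -> bnd v = 0 ->
  (forall u, rnorm (g u - g v) <= bnd u) -> {for v, continuous g}.
Proof.
move=> cb b0 hb; apply/(@cvgrPdist_lt _ _ _ (nbhs v)) => e e0.
have e1 : 0 < re e by move: e0; rewrite ltCE => /andP[].
have hN : \forall u \near v, bnd u < re e.
  apply: (cb [set t | t < re e]); apply: open_nbhs_nbhs; split; first exact: open_lt.
  by rewrite /= b0.
near=> u; rewrite norm_rnorm ltCE (gt0_realC e0) /= eqxx /=.
by rewrite rnorm_distC; apply: le_lt_trans (hb u) _; near: u.
Unshelve. all: by end_near. Qed.

Lemma continuous_rnormB (V : normedModType (Cplx R)) (v : V) :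
  {for v, continuous (fun u : V => rnorm (u - v))}.
Proof.
apply: (@continuous_comp _ _ _ (fun u : V => u - v) (@rnorm R V)).
  by apply: continuousB => //; exact: cvg_cst.
exact: continuous_rnorm.
Qed.

Lemma continuous_star_mul (A : cstarAlgebra R) :
  continuous (fun a : A => cs_mul (cs_star a) a).
Proof.
move=> v; apply: (@continuous_rnorm_bound _ _ _
  (fun u => rnorm u * rnorm (u - v) + rnorm (u - v) * rnorm v)).
- apply: continuousD; apply: continuousM; do ?exact: continuous_rnormB.
    exact: continuous_rnorm.
  exact: cvg_cst.
- by rewrite subrr rnorm0 mulr0 mul0r addr0.
- move=> u; rewrite -(subrKC (cs_mul (cs_star u) v) (cs_mul (cs_star u) u)).
  rewrite addrAC -cs_mulBr -cs_mulBl -cs_starB addrC.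
  apply: le_trans (rnormD _ _) _; apply: lerD.
    by apply: le_trans (rnorm_mul _ _) _; rewrite rnorm_star.
  by apply: le_trans (rnorm_mul _ _) _; rewrite rnorm_star.
Qed.

Lemma continuous_sqabs : continuous (@sqabs R).
Proof.
move=> z; apply: (@cvgD _ R^o _ (nbhs z) _ (fun z => re z ^+ 2) (fun z => im z ^+ 2)).
  apply: (@continuous_comp _ _ _ (@re R : Cplx R -> R) (fun x : R => x ^+ 2)).
    exact: continuous_re.
  exact: exprn_continuous.
apply: (@continuous_comp _ _ _ (@im R : Cplx R -> R) (fun x : R => x ^+ 2)).
  exact: continuous_im.
exact: exprn_continuous.
Qed.

Lemma esum_finite_support (I : choiceType) (D : set I) (a : I -> R) :
  (forall i, 0 <= a i) -> finite_set (D `&` a @^-1` [set~ 0]) ->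
  \esum_(i in D) (a i)%:E = (\sum_(i \in D) a i)%:E.
Proof.
move=> a0 fin; rewrite (esumID (a @^-1` [set~ 0])); last by move=> i _; rewrite lee_fin.
rewrite [X in (_ + X)%E]esum1 ?adde0; last first.
  by move=> i [_ /=]; rewrite notK => ->.
rewrite esum_fset //; last by move=> i _; rewrite lee_fin.
by rewrite fsumEFin // -fsbig_supp.
Qed.

End NormContinuity.

Section EvaluationState.
Context {R : realType} {G : ptopologicalType} (Gd : groupoid G) (X : set G).
Hypothesis Gtop : topological_groupoid Gd.
Hypothesis Glc : locally_compact [set: G].
Hypothesis GT2 : hausdorff_space G.
Hypothesis Xtr : compact_transversal Gd X.
Hypothesis Het : etale_HX Gd X.
Context (sigma : G -> G -> Cplx R).
Hypothesis sigma_coc : normalised_cocycle Gd sigma.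
Context (A : cstarAlgebra R) (iA : (G -> Cplx R) -> A).
Hypothesis hA : reduced_completion Gd X sigma iA.
Context (x : G) (w : A -> Cplx R).
Hypothesis Xx : X x.
Hypothesis hw : evaluation_state Gd X iA x w.
Local Notation r := (gr Gd).
Local Notation s := (gs Gd).
Local Notation inv := (ginv Gd).
Local Notation H := (HX Gd X).
Local Notation Fx := [set z | H z /\ r z = x].

Let state_w : cs_state w. Proof. by case: hw. Qed.

(** [f1^* f2] is the class of a compactly supported function, on which the state
    is evaluation at [x]. *)
Lemma state_conv f1 f2 : Cc H f1 -> Cc H f2 ->
  w (cs_mul (cs_star (iA f1)) (iA f2)) =
  \sum_(z \in Fx) (f1 (inv z))^* * f2 (inv z).
Proof.
move=> c1 c2; rewrite -(rc_star hA) // -(rc_mul hA) //; last exact: Cc_invol.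
have [_ ->] := hw; first by rewrite conv_unit.
by apply: Cc_conv => //; exact: Cc_invol.
Qed.

Lemma exists_point_masses : exists b : G -> G -> Cplx R, forall z, Fx z ->
  [/\ Cc H (b z), b z (inv z) = 1 &
      forall g, H g -> s g = x -> g <> inv z -> b z g = 0].
Proof.
have /choice[b hb] (z : G) : exists b : G -> Cplx R, Fx z ->
    [/\ Cc H b, b (inv z) = 1 & forall g, H g -> s g = x -> g <> inv z -> b g = 0].
  case: (pselect (Fx z)) => [[Hz rz]|]; last by exists 0.
  have [b cb [b1 b0]] := point_mass (R := R) Gtop Glc GT2 Xtr Het (HX_inv Hz).
  by exists b => _; split => // g Hg sg gz; apply: b0 => //; rewrite g_sV rz.
by exists b.
Qed.

Lemma state_point_mass (z : G) (b f : G -> Cplx R) : Fx z -> Cc H b ->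
  b (inv z) = 1 -> (forall g, H g -> s g = x -> g <> inv z -> b g = 0) ->
  Cc H f -> w (cs_mul (cs_star (iA b)) (iA f)) = f (inv z).
Proof.
move=> Fz cb b1 b0 cf; rewrite state_conv //.
rewrite -(@fsbig_widen _ _ _ _ [set z]); first by rewrite fsbig_set1 b1 rmorph1 mul1r.
  by move=> _ ->.
move=> y [[Hy ry] yz] /=; rewrite b0 ?rmorph0 ?mul0r //; first exact: HX_inv.
  by rewrite g_sV.
by move=> /(congr1 inv); rewrite !g_invK => e; exact: yz.
Qed.

(** The case [f1 = f2] of [state_conv]: since the support of [f] meets the fibre
    in a finite set, the sum over the fibre is a finite one. *)
Lemma state_square f : Cc H f ->
  \esum_(z in Fx) (sqabs (f (inv z)))%:E = (re (w (cs_mul (cs_star (iA f)) (iA f))))%:E.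
Proof.
move=> cf; rewrite state_conv //.
have [_ [K [cK KH K0]]] := cf.
have fin : finite_set (Fx `&` (fun z => sqabs (f (inv z))) @^-1` [set~ 0]).
  have cK' : compact (inv @` K).
    apply: continuous_compact => //.
    by apply: continuous_subspaceT; exact: tg_inv.
  apply: (sub_finite_set _ (finite_fibre Gtop GT2 Het x cK' _)).
    move=> z [[Hz rz] nz]; split => //; apply: contrapT => nK; apply: nz => /=.
    rewrite K0 ?/sqabs ?re0 ?im0 ?expr0n ?addr0 // => Kz; apply: nK.
    by exists (inv z) => //; rewrite g_invK.
  by move=> _ [g /KH Hg <-]; exact: HX_inv.
rewrite esum_finite_support //; last by move=> z; exact: sqabs_ge0.
congr (_%:E).
have -> : \sum_(z \in Fx) (f (inv z))^* * f (inv z) =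
    \sum_(z \in Fx) realC (sqabs (f (inv z))).
  by apply: eq_fsbigr => z _; rewrite conjM_sqabs.
rewrite [LHS]fsbig_supp.
rewrite -(@fsbig_widen _ _ _ _ (Fx `&` (fun z => sqabs (f (inv z))) @^-1` [set~ 0]) Fx).
- by rewrite !fsbig_finite // re_sum.
- by move=> z [].
- by move=> z /= [Fz]; rewrite not_andP notK => -[//|->].
Qed.

Lemma continuous_state_square : continuous (fun a : A => re (w (cs_mul (cs_star a) a))).
Proof.
move=> a; apply: (@continuous_comp _ _ _ (fun a : A => w (cs_mul (cs_star a) a)) (@re R)).
  apply: (@continuous_comp _ _ _ (fun a : A => cs_mul (cs_star a) a) w).
    exact: continuous_star_mul.
  exact: continuous_state.
exact: continuous_re.
Qed.

(** On the class of a continuous function [f] both sides are the sum of the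
    squared values of [f] on the fibre of [s] over [x]; the general case follows
    by density.  In other words, point masses form an orthonormal basis of the
    representation space of the state. *)
Lemma state_parseval (b : G -> G -> Cplx R) :
  (forall z, Fx z -> [/\ Cc H (b z), b z (inv z) = 1 &
      forall g, H g -> s g = x -> g <> inv z -> b z g = 0]) ->
  forall a, \esum_(z in Fx) (sqabs (w (cs_mul (cs_star (iA (b z))) a)))%:E =
    (re (w (cs_mul (cs_star a) a)))%:E.
Proof.
move=> hb.
apply: (parseval_dense (S := iA @` Cc H) (l := fun z a => w (cs_mul (cs_star (iA (b z))) a))).
- by move=> z _ u v; rewrite cs_mulBr stateB.
- move=> z _; exists (rnorm (iA (b z)) ^+ 2) => v; rewrite -exprMn.
  apply: le_trans (sqabs_state state_w _) _.
  rewrite lerXn2r ?nnegrE ?mulr_ge0 ?rnorm_ge0 //.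
  by apply: le_trans (rnorm_mul _ _) _; rewrite rnorm_star.
- exact: continuous_state_square.
- by rewrite cs_mulr0 state0.
- exact: (rc_dense hA).
- move=> _ [f cf <-]; rewrite -state_square //; apply: eq_esum => z Fz.
  by have [? ? ?] := hb z Fz; rewrite (state_point_mass Fz).
Qed.

(** Kadison's inequality: [w a] is the coefficient of [a] at the unit [x]. *)
Lemma state_kadison (a : A) : sqabs (w a) <= re (w (cs_mul (cs_star a) a)).
Proof.
(* The unit [x] lies in its own fibre and is its own inverse. *)
have rx : r x = x := tr_units Xtr Xx.
have sx : s x = x by rewrite -{1}rx g_sr.
have ix : inv x = x.
  by rewrite -[LHS](g_mulg1 Gd) g_sV rx g_mulVg.
have Fxx : Fx x by split => //; split; rewrite ?sx ?rx.
rewrite -subr_ge0.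
apply: (@dense_ge R A (iA @` Cc H) (fun a => re (w (cs_mul (cs_star a) a)) - sqabs (w a))).
- exact: (rc_dense hA).
- apply: continuousB; first exact: continuous_state_square.
  apply: (@continuous_comp _ _ _ w (@sqabs R)); first exact: continuous_state.
  exact: continuous_sqabs.
- move=> _ [f cf <-]; rewrite subr_ge0 -lee_fin -state_square //.
  have [_ ->] := hw => //; rewrite -{1}ix.
  apply: esum_ge; exists [set x]; first by split => // _ ->.
  by rewrite fsbig_set1.
Qed.

End EvaluationState.

(** * Borel measures determined by compactly supported functions *)

Section BorelMeasurability.
Context {R : realType} {G : ptopologicalType}.

Lemma open_borel (U : set G) : open U -> measurable (U : set (borel G)).
Proof. by move=> oU; exact: sub_sigma_algebra. Qed.

Lemma closed_borel (C : set G) : closed C -> measurable (C : set (borel G)).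
Proof. by move=> /closed_openC/open_borel/measurableC; rewrite setCK. Qed.

Lemma within_borel (D : set G) (f : G -> G) :
  measurable (D : set (borel G)) -> {within D, continuous f} ->
  measurable_fun (D : set (borel G)) (f : borel G -> borel G).
Proof.
move=> mD /continuousP cf; apply: (@measurability _ _ (borel G) (borel G) D f (@open G) erefl).
move=> _ [U oU <-]; have /open_subspaceP[V oV VD] := cf _ oU.
by rewrite setIC -VD; apply: measurableI => //; exact: open_borel.
Qed.

Lemma within_borelR (D : set G) (f : G -> R) :
  measurable (D : set (borel G)) -> {within D, continuous f} ->
  measurable_fun (D : set (borel G)) (f : borel G -> R).
Proof.
move=> mD /continuousP cf; apply: (measurability _ (RGenOpens.measurableE R)).
move=> _ [_ [a [b ->] <-]].
have /open_subspaceP[V oV VD] := cf _ (@interval_open R (BRight a) (BLeft b) isT isT).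
by rewrite setIC -VD; apply: measurableI => //; exact: open_borel.
Qed.
End BorelMeasurability.

Section RadonUniqueness.
Context {R : realType} {G : ptopologicalType}.
Hypothesis Glc : locally_compact [set: G].
Hypothesis GT2 : hausdorff_space G.
Hypothesis Gsc : @second_countable G.

Definition bump_in (U : set G) (f : G -> R) : Prop :=
  [/\ continuous f, forall y, 0 <= f y <= 1 &
      exists K, [/\ compact K, K `<=` U & forall y, ~ K y -> f y = 0]].

Lemma bump_in0 U : bump_in U (fun=> 0).
Proof.
split; [by move=> y; exact: cvg_cst|by move=> y; rewrite lexx ler01|].
by exists set0; split => //; exact: compact0.
Qed.

Lemma bump_in_max U f g : bump_in U f -> bump_in U g ->
  bump_in U (fun y => Num.max (f y) (g y)).
Proof.
move=> [cf f01 [K [cK KU K0]]] [cg g01 [L [cL LU L0]]]; split.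
- by move=> y; apply: (@continuous_max R G f g); [exact: cf|exact: cg].
- move=> y; have /andP[f0 f1] := f01 y; have /andP[g0 g1] := g01 y.
  by rewrite le_max f0 ge_max f1.
- exists (K `|` L); split; first exact: compactU.
    by move=> y [/KU|/LU].
  move=> y nKL; rewrite K0 ?L0 ?maxxx // => h; apply: nKL; [by right|by left].
Qed.

Lemma bump_in_double U f : bump_in U f ->
  bump_in U (fun y => Num.min 1 (2 * f y)).
Proof.
move=> [cf f01 [K [cK KU K0]]]; split.
- move=> y; apply: (@continuous_min R G (fun=> 1) (fun y => 2 * f y)); first exact: cvg_cst.
  by apply: continuousM; [exact: cvg_cst|exact: cf].
- move=> y; have /andP[f0 f1] := f01 y.
  by rewrite le_min ler01 mulr_ge0 //= ge_min lexx.
- by exists K; split => // y /K0 ->; rewrite mulr0 min_r.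
Qed.

(** For each set of a countable base on which the double of some bump function
    exceeds 1, choose such a function.  Truncate the doubles at 1 and take the
    maxima of the first [n] of them: at a point of [U] the sequence reaches 1 as
    soon as a basic neighbourhood of the point has been enumerated. *)
Lemma open_exhaustion (U : set G) : open U -> exists F : nat -> G -> R,
  [/\ forall n, bump_in U (F n), forall y, {homo F^~ y : n m / (n <= m)%N >-> n <= m} &
      forall y, U y -> exists n, forall m, (n <= m)%N -> F m y = 1].
Proof.
move=> oU; have [B /countable_injP[idx idxI] [Bo Bb]] := Gsc.
have /choice[g hg] (n : nat) : exists g : G -> R, bump_in U g /\
    forall V, B V -> idx V = n ->
      (exists2 f, bump_in U f & forall y, V y -> 1 < 2 * f y) ->
      forall y, V y -> 1 < 2 * g y.
  have [[V [BV [iV [f bf Vf]]]]|nV] := pselect (exists V, B V /\ (idx V = n /\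
      exists2 f, bump_in U f & forall y, V y -> 1 < 2 * f y)).
    exists f; split => // V' BV' iV' _.
    by have <- : V = V' by apply: idxI; rewrite ?inE // iV.
  exists (fun=> 0); split; first exact: bump_in0.
  by move=> V BV iV h; case: nV; exists V.
pose F := fix F n := if n is m.+1 then
  (fun y => Num.max (F m y) (Num.min 1 (2 * g m y))) else (fun=> 0).
have FS n y : F n.+1 y = Num.max (F n y) (Num.min 1 (2 * g n y)) by [].
have Fb n : bump_in U (F n).
  elim: n => [|n IH]; first exact: bump_in0.
  by apply: bump_in_max => //; apply: bump_in_double; have [] := hg n.
have Fmon y : {homo F^~ y : n m / (n <= m)%N >-> n <= m}.
  by apply/nondecreasing_seqP => n; rewrite FS le_max lexx.
exists F; split => // y Uy.
have [f cf [f01 f1 Kf]] := bump_function R Glc GT2 oU Uy.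
have : nbhs y [set z | 1 < 2 * f z].
  apply: (@cvgM _ _ (nbhs y) _ (fun=> 2) f 2 (f y) (cvg_cst _) (cf y)
    [set t | 1 < t]).
  apply: open_nbhs_nbhs; split; first exact: open_gt.
  by rewrite /= f1 mulr1 ltr1n.
move=> /Bb[V [BV Vy] Vf].
exists (idx V).+1 => m hm; apply/eqP; rewrite eq_le.
have [_ F01 _] := Fb m; have /andP[_ ->] := F01 y.
rewrite /= -(@ler_pM2l _ 1) // !mul1r; apply: le_trans (Fmon y _ _ hm).
rewrite FS le_max; apply/orP; right; rewrite le_min lexx /= ltW //.
have [_ h] := hg (idx V); apply: (h V) => //.
by exists f; [split|].
Qed.

Lemma bump_in_measurable U f : bump_in U f ->
  measurable_fun setT (f : borel G -> R).
Proof.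
by move=> [cf _ _]; apply: within_borelR => //; exact: continuous_subspaceT.
Qed.

(** By [open_exhaustion] and monotone convergence the measures agree on open
    sets.  These form a pi-system which generates the Borel sets, and the sets
    where the functions of an exhaustion of the whole space are positive have
    finite measure. *)
Lemma radon_unique (m1 m2 : {measure set (borel G) -> \bar R}) :
  (forall K : set G, compact K -> (m1 K < +oo)%E) ->
  (forall f, bump_in setT f -> (\int[m1]_y (f y)%:E = \int[m2]_y (f y)%:E)%E) ->
  forall B : set (borel G), measurable B -> m1 B = m2 B.
Proof.
move=> m1K m12.
have conv (m : {measure set (borel G) -> \bar R}) (U : set G) (F : nat -> G -> R) :
    open U -> (forall n, bump_in U (F n)) ->
    (forall y, {homo F^~ y : n m / (n <= m)%N >-> n <= m}) ->
    (forall y, U y -> exists n, forall m, (n <= m)%N -> F m y = 1) ->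
    (m U = limn (fun n => \int[m]_y (F n y)%:E))%E.
  move=> oU Fb Fmon F1; have mU := open_borel oU.
  have -> : m U = (\int[m]_y (\1_U y)%:E)%E by rewrite integral_indic // setIT.
  rewrite -monotone_convergence //=.
  - apply: eq_integral => y _; apply/esym/cvg_lim => //.
    apply: cvg_near_cst; rewrite indicE.
    have [Uy|nUy] := boolP (y \in U).
      have [n hn] := F1 y (set_mem Uy).
      by exists n => // k /= /hn ->.
    exists 0%N => // k _; have [_ _ [K [_ KU K0]]] := Fb k.
    by rewrite K0 // => /KU Uy; move/negP : nUy; apply; rewrite inE.
  - by move=> n; apply/measurable_EFinP; exact: (bump_in_measurable (Fb n)).
  - by move=> n y _; have [_ /(_ y)/andP[F0 _] _] := Fb n; rewrite lee_fin.
  - by move=> y _ n m' nm; rewrite lee_fin; exact: Fmon.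
have mopen (U : set G) : open U -> m1 U = m2 U.
  move=> oU; have [F [Fb Fmon F1]] := open_exhaustion oU.
  rewrite (conv m1 U F) // (conv m2 U F) //; congr (limn _); apply/funext => n.
  apply: m12; have [? ? [K [? ? ?]]] := Fb n; split => //.
  by exists K.
have [F [Fb Fmon F1]] := open_exhaustion openT.
move=> B mB; apply: (@measure_unique _ R (borel G) (@open G)
  (fun n => F n @^-1` [set t | 0 < t]) erefl _ _ _ m1 m2 mopen _ B mB).
- exact: openI.
- move=> n; have [cf _ _] := Fb n.
  by apply: open_comp => [y _|]; [exact: cf|exact: open_gt].
- apply/seteqP; split => // y _; have [n hn] := F1 y I.
  by exists n => //=; rewrite hn.
- move=> n; have [cf _ [K [cK _ K0]]] := Fb n.
  apply: le_lt_trans (m1K K cK); apply: le_measure; rewrite ?inE.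
  + by apply: open_borel; apply: open_comp => [y _|]; [exact: cf|exact: open_gt].
  + by apply: closed_borel; exact: compact_closed.
  + by move=> y /= Fy; apply: contrapT => /K0 F0; move: Fy; rewrite F0 ltxx.
Qed.

End RadonUniqueness.

(** * Invariance of the Haar system on Borel sets *)

Section HaarTranslation.
Context {R : realType} {G : ptopologicalType} (Gd : groupoid G).
Hypothesis Gtop : topological_groupoid Gd.
Hypothesis Glc : locally_compact [set: G].
Hypothesis GT2 : hausdorff_space G.
Hypothesis Gsc : @second_countable G.
Context (nu : G -> {measure set (borel G) -> \bar R}).
Hypothesis hnu : haar_system Gd nu.
Local Notation r := (gr Gd).
Local Notation s := (gs Gd).
Local Notation inv := (ginv Gd).
Local Notation mul := (gmul Gd).

Definition r_fibre (u : G) : set G := [set g | r g = u].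

Lemma closed_r_fibre u : closed (r_fibre u).
Proof.
have -> : r_fibre u = r @^-1` [set u] by [].
by apply: closed_comp => [z _|]; [exact: tg_r|exact: closed_point].
Qed.

Lemma measurable_r_fibre u : measurable (r_fibre u : set (borel G)).
Proof. by apply: closed_borel; exact: closed_r_fibre. Qed.

Lemma haar_off_fibre u : units Gd u -> nu u (~` r_fibre u) = 0%E.
Proof.
move=> uu; apply/(haar_supp hnu uu); first exact/closed_openC/closed_r_fibre.
exact: setICl.
Qed.

(** The measure [nu u] is concentrated on the fibre of [r] over [u], which
    settles the difference between integrals over the fibre and over [G]. *)
Lemma haar_integral_fibre u (f : G -> \bar R) : units Gd u ->
  measurable_fun setT (f : borel G -> \bar R) -> (forall g, 0 <= f g)%E ->
  (\int[nu u]_g f g = \int[nu u]_(g in r_fibre u) f g)%E.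
Proof.
move=> uu mf f0.
rewrite (@ge0_negligible_integral _ (borel G) R (nu u) setT (~` r_fibre u)) //.
- by rewrite setTD setCK.
- by apply: measurableC; exact: measurable_r_fibre.
- exact: haar_off_fibre.
Qed.

Lemma integral_bounded_lty (m : {measure set (borel G) -> \bar R}) (D L : set G)
    (f : G -> R) :
  measurable (D : set (borel G)) -> measurable_fun (D : set (borel G)) (f : borel G -> R) ->
  (forall g, D g -> 0 <= f g <= 1) -> (forall g, D g -> ~ L g -> f g = 0) ->
  compact L -> (m L < +oo)%E -> (\int[m]_(g in D) (f g)%:E < +oo)%E.
Proof.
move=> mD mf f01 f0 cL mL.
have mLs : measurable (L : set (borel G)) by apply: closed_borel; exact: compact_closed.
apply: (@le_lt_trans _ _ (\int[m]_(g in D) (\1_L g)%:E)%E).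
  apply: ge0_le_integral => //.
  - by move=> g /f01/andP[? _]; rewrite lee_fin.
  - exact/measurable_EFinP.
  - exact/measurable_EFinP/measurable_indic.
  - move=> g Dg; rewrite lee_fin indicE; have /andP[_ f1] := f01 g Dg.
    case: (boolP (g \in L)) => //; rewrite notin_setE => nL.
    by rewrite f0.
rewrite integral_indic //; apply: le_lt_trans mL.
by apply: le_measure; rewrite ?inE //; exact: measurableI.
Qed.

(** Left translation by [gamma] is meaningful on one fibre of [r]; the constant
    value elsewhere makes it a Borel map defined everywhere, along which
    measures can be pushed forward. *)
Definition translation (gamma : G) (h : G) : G :=
  if h \in r_fibre (s gamma) then mul gamma h else gamma.

Lemma within_mul_left gamma :
  {within r_fibre (s gamma), continuous (mul gamma)}.
Proof.
apply: (@within_comp _ _ _ _ (composable Gd) (fun h => (gamma, h))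
  (fun q : G * G => mul q.1 q.2)).
- apply: within_pair; first by apply: continuous_subspaceT => ?; exact: cvg_cst.
  by apply: continuous_subspaceT => ?.
- exact: tg_mul.
- by move=> h /= rh; rewrite /composable /= rh.
Qed.

Lemma measurable_translation gamma :
  measurable_fun setT (translation gamma : borel G -> borel G).
Proof.
have mD := measurable_r_fibre (s gamma).
rewrite -(setUv (r_fibre (s gamma) : set (borel G))).
apply/measurable_funU => //; first exact: measurableC.
split.
- apply: (@eq_measurable_fun _ _ (borel G) (borel G) _ (mul gamma)).
    by move=> h hD; rewrite /translation hD.
  by apply: within_borel => //; exact: within_mul_left.
- apply: (@eq_measurable_fun _ _ (borel G) (borel G) _ (fun=> gamma)).
    by move=> h; rewrite inE /translation => /= nh; rewrite ifN // notin_setE.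
  exact: measurable_cst.
Qed.

(** The invariance hypothesis compares real numbers obtained from possibly
    infinite integrals; for bump functions all integrals are finite, since they
    are bounded by the measure of a compact set. *)
Lemma haar_bump_invariant gamma (f : G -> R) : bump_in setT f ->
  (\int[nu (r gamma)]_g (f g)%:E =
   \int[nu (s gamma)]_g (f (translation gamma g))%:E)%E.
Proof.
move=> bf; have [cf f01 [K [cK _ K0]]] := bf.
have ur : units Gd (r gamma) by rewrite /units /= g_rr.
have us : units Gd (s gamma) by rewrite /units /= g_rs.
have mfT := bump_in_measurable bf.
have mft : measurable_fun setT (fun g : borel G => f (translation gamma g)).
  exact: (measurableT_comp mfT (measurable_translation gamma)).
rewrite !haar_integral_fibre //; last first.
- by move=> g; rewrite lee_fin; have /andP[] := f01 g.
- exact/measurable_EFinP.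
- by move=> g; rewrite lee_fin; have /andP[] := f01 (translation gamma g).
- exact/measurable_EFinP.
have Cf : Cc setT (fun g => realC (f g) : Cplx R).
  split.
    apply: continuous_subspaceT => g.
    by apply: continuous_comp; [exact: cf|exact: continuous_realC].
  by exists K; split => // g /K0 ->.
have [] := haar_invariant hnu gamma Cf; rewrite /Rintegral /= => e _.
set I1 := (\int[nu (r gamma)]_(g in _) _)%E.
have -> : (\int[nu (s gamma)]_(g in r_fibre (s gamma)) (f (translation gamma g))%:E =
  \int[nu (s gamma)]_(g in r_fibre (s gamma)) (f (mul gamma g))%:E)%E.
  by apply: eq_integral => g gD; rewrite /translation gD.
set I2 := (\int[nu (s gamma)]_(g in _) _)%E.
have {}e : fine I2 = fine I1 by [].
have I1fin : I1 \is a fin_num.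
  rewrite ge0_fin_numE; last by apply: integral_ge0 => g _; rewrite lee_fin; have /andP[] := f01 g.
  apply: (integral_bounded_lty (L := K)) => //.
  - exact: measurable_r_fibre.
  - exact: measurable_funTS.
  - by move=> g _; exact: K0.
  - exact: (haar_compact hnu).
have I2fin : I2 \is a fin_num.
  rewrite ge0_fin_numE; last first.
    by apply: integral_ge0 => g _; rewrite lee_fin; have /andP[] := f01 (mul gamma g).
  have cL : compact (mul (inv gamma) @` (K `&` r_fibre (r gamma))).
    apply: continuous_compact.
      apply: (continuous_subspaceW _ (@within_mul_left (inv gamma))) => g [_].
      by rewrite /r_fibre /= g_sV.
    by apply: compact_closedI => //; exact: closed_r_fibre.
  apply: (integral_bounded_lty (L := mul (inv gamma) @` (K `&` r_fibre (r gamma)))) => //.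
  - exact: measurable_r_fibre.
  - apply: (@eq_measurable_fun _ _ (borel G) R _ (fun g => f (translation gamma g))).
      by move=> g gD; rewrite /translation gD.
    exact: measurable_funTS.
  - move=> g /= rg ng; apply: K0 => Kg; apply: ng.
    exists (mul gamma g); first by split => //; rewrite /r_fibre /= g_rM // rg.
    by rewrite g_mulVK // rg.
  - exact: (haar_compact hnu).
by rewrite -(fineK I1fin) -(fineK I2fin) e.
Qed.

(** Both sides are Borel measures in [B] which agree on bump functions, by
    [haar_bump_invariant], so that [radon_unique] applies. *)
Lemma haar_translation gamma (B : set (borel G)) : measurable B ->
  nu (r gamma) B = nu (s gamma) (translation gamma @^-1` B).
Proof.
move=> mB; have mT := measurable_translation gamma.
pose m2 : {measure set (borel G) -> \bar R} :=
  pushforward (nu (s gamma)) (translation gamma : borel G -> borel G).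
suff -> : nu (r gamma) B = m2 mT B by [].
apply: (radon_unique Glc GT2 Gsc) mB.
  by move=> K; apply: (haar_compact hnu); rewrite /units /= g_rr.
move=> f bf; rewrite haar_bump_invariant //.
apply/esym/(ge0_integral_pushforward mT) => //.
- by apply/measurable_EFinP; exact: (bump_in_measurable bf).
- by move=> g _; rewrite lee_fin; have [_ /(_ g)/andP[]] := bf.
Qed.

Lemma haar_integral_translation gamma (k : G -> \bar R) :
  measurable_fun setT (k : borel G -> \bar R) -> (forall g, 0 <= k g)%E ->
  (\int[nu (r gamma)]_g k g = \int[nu (s gamma)]_g k (translation gamma g))%E.
Proof.
move=> mk k0; have mT := measurable_translation gamma.
rewrite -[RHS](@ge0_integral_pushforward _ _ _ _ _ _ mT _ setT k) //.
by apply: eq_measure_integral => B mB _; exact: haar_translation.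
Qed.

End HaarTranslation.

(** * Vectors as square-integrable functions on a fibre *)

Section SquareIntegrable.
Context {R : realType} {d : measure_display} {T : measurableType d}.
Context (mu : {measure set T -> \bar R}) (D : set T).
Hypothesis mD : measurable D.
Implicit Types a b : T -> Cplx R.

Definition cmeasurable a : Prop :=
  measurable_fun D (fun t => re (a t)) /\ measurable_fun D (fun t => im (a t)).

Lemma cmeasurableB a b : cmeasurable a -> cmeasurable b ->
  cmeasurable (fun t => a t - b t).
Proof.
move=> [ra ia] [rb ib]; split.
  by under eq_fun do rewrite reB; exact: measurable_funB.
by under eq_fun do rewrite imB; exact: measurable_funB.
Qed.

Lemma cmeasurableM a b : cmeasurable a -> cmeasurable b ->
  cmeasurable (fun t => a t * b t).
Proof.
move=> [ra ia] [rb ib]; split.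
  under eq_fun do rewrite reM.
  by apply: measurable_funB; exact: measurable_funM.
under eq_fun do rewrite imM.
by apply: measurable_funD; exact: measurable_funM.
Qed.

Lemma measurable_sqabs a : cmeasurable a -> measurable_fun D (fun t => sqabs (a t)).
Proof.
by move=> [ra ia]; apply: measurable_funD; exact: measurable_funX.
Qed.

Lemma measurable_esqabs a : cmeasurable a ->
  measurable_fun D (fun t => (sqabs (a t))%:E).
Proof. by move=> /measurable_sqabs ?; exact/measurable_EFinP. Qed.

Let L2 a : Prop := cmeasurable a /\ (\int[mu]_(t in D) (sqabs (a t))%:E < +oo)%E.

Let integrable_sqabs a : L2 a -> mu.-integrable D (EFin \o (fun t => sqabs (a t))).
Proof.
move=> [ma ia]; apply/integrableP; split; first exact: measurable_esqabs.
under eq_integral do rewrite gee0_abs ?lee_fin ?sqabs_ge0 //.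
exact: ia.
Qed.

Let integrable_conjM a b : L2 a -> L2 b ->
  mu.-integrable D (EFin \o (fun t => re ((a t)^* * b t))).
Proof.
move=> La Lb; have := integrableD mD (integrable_sqabs La) (integrable_sqabs Lb).
have [[[ra ia] _] [[rb ib] _]] := (La, Lb).
apply: le_integrable => //.
  apply/measurable_EFinP; under eq_fun do rewrite re_conjM.
  by apply: measurable_funD; exact: measurable_funM.
move=> t _; rewrite /= lee_fin [leRHS]ger0_norm; last by apply: addr_ge0; exact: sqabs_ge0.
rewrite re_conjM /sqabs; move: (re (a t)) (im (a t)) (re (b t)) (im (b t)) => p q u v.
have [? ? ? ?] : [/\ 0 <= (p - u) ^+ 2, 0 <= (p + u) ^+ 2, 0 <= (q - v) ^+ 2 &
  0 <= (q + v) ^+ 2] by rewrite !sqr_ge0.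
by rewrite ler_norml; apply/andP; split; nra.
Qed.

(** Expanding the square is legitimate because the product of two
    square-integrable functions is integrable. *)
Lemma integral_sqabsB a b : L2 a -> L2 b ->
  (\int[mu]_(t in D) (sqabs (a t - b t))%:E =
  (re (cintegral mu D (fun t => (a t)^* * a t)%R) +
   re (cintegral mu D (fun t => (b t)^* * b t)%R) -
   2 * re (cintegral mu D (fun t => (a t)^* * b t)%R))%:E)%E.
Proof.
move=> La Lb; have Iab := integrable_conjM La Lb.
have Iaa := integrable_conjM La La; have Ibb := integrable_conjM Lb Lb.
have I1 : mu.-integrable D (EFin \o (fun t => re ((a t)^* * a t) + re ((b t)^* * b t))).
  by apply: eq_integrable (integrableD mD Iaa Ibb) => // t _; rewrite /= EFinD.
have I2 : mu.-integrable D (EFin \o (fun t => 2 * re ((a t)^* * b t))).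
  by apply: eq_integrable (integrableZl mD 2 Iab) => // t _; rewrite /= EFinM.
have I3 : mu.-integrable D (EFin \o (fun t => re ((a t)^* * a t) +
    re ((b t)^* * b t) - 2 * re ((a t)^* * b t))).
  by apply: eq_integrable (integrableB mD I1 I2) => // t _; rewrite /= EFinB.
rewrite /cintegral /= -(RintegralZl 2 mD Iab) -(RintegralD mD Iaa Ibb).
rewrite -(RintegralB mD I1 I2) /Rintegral fineK; last exact: integrable_fin_num I3.
apply: eq_integral => t _; rewrite sqabsB !re_conjM /sqabs.
by congr (_%:E); ring.
Qed.

End SquareIntegrable.

Section FibreSpaces.
Context {R : realType} {G : ptopologicalType} (Gd : groupoid G).
Hypothesis Gtop : topological_groupoid Gd.
Hypothesis Glc : locally_compact [set: G].
Hypothesis GT2 : hausdorff_space G.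
Hypothesis Gsc : @second_countable G.
Context (nu : G -> {measure set (borel G) -> \bar R}).
Hypothesis hnu : haar_system Gd nu.
Context (X : set G).
Hypothesis Xtr : compact_transversal Gd X.
Context (A : cstarAlgebra R) (E : hilbertModule A) (iE : (G -> Cplx R) -> E).
Local Notation r := (gr Gd).
Local Notation s := (gs Gd).
Local Notation inv := (ginv Gd).
Local Notation mul := (gmul Gd).

Section OneFibre.
Context (x : G) (w : A -> Cplx R) (h : fibre_space G E).
Hypothesis Xx : X x.
Hypothesis state_w : cs_state w.
Hypothesis hh : fibre_completion Gd X nu iE x w h.

(** The measure [nu x] lives on the fibre of [r], while vectors are functions on
    the fibre of [s]. *)
Definition fibre_fun (psi : h) (g : G) : Cplx R := fs_fun psi (inv g).

Lemma fs_mapB (e f : E) : fs_map h (e - f) = fs_map h e - fs_map h f.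
Proof. by rewrite addrC -scaleN1r (fc_linear hh) scaleN1r addrC. Qed.

Lemma rnorm_fs_map_sqr (e : E) : rnorm (fs_map h e) ^+ 2 = re (w (hm_ip e e)).
Proof. by rewrite -re_hs_norm (fc_ip hh). Qed.

Lemma rnorm_fs_map (e : E) : rnorm (fs_map h e) <= rnorm e.
Proof.
rewrite -ler_sqr ?nnegrE ?rnorm_ge0 // rnorm_fs_map_sqr hm_rnorm.
exact: re_state_le.
Qed.

Lemma measurable_inv : measurable_fun setT (inv : borel G -> borel G).
Proof. by apply: within_borel => //; apply: continuous_subspaceT; exact: tg_inv. Qed.

Lemma cmeasurable_fibre_fun psi :
  cmeasurable (T := borel G) setT (fibre_fun psi).
Proof.
have [m1 m2 _] := fc_L2 hh psi; split.
  exact: (measurableT_comp m1 measurable_inv).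
exact: (measurableT_comp m2 measurable_inv).
Qed.

(** Both sides expand into the same three inner products, because inner products
    of vectors are integrals of the functions representing them.  The
    difference is one of representatives because their choice need not be linear. *)
Lemma integral_fibre_dist (psi phi : h) :
  (\int[nu x]_g (sqabs (fibre_fun psi g - fibre_fun phi g))%:E =
   (rnorm (psi - phi) ^+ 2)%:E)%E.
Proof.
have ux : units Gd x := tr_units Xtr Xx.
have mD := measurable_r_fibre Gtop GT2 x.
have mp := cmeasurable_fibre_fun psi; have mq := cmeasurable_fibre_fun phi.
have cD f : cmeasurable (T := borel G) setT f -> cmeasurable (T := borel G) (r_fibre Gd x) f.
  by move=> [? ?]; split; exact: measurable_funTS.
have LD f : cmeasurable (T := borel G) setT f ->
   (\int[nu x]_g (sqabs (f g))%:E < +oo)%E ->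
   (\int[nu x]_(g in r_fibre Gd x) (sqabs (f g))%:E < +oo)%E.
  move=> mf; rewrite (haar_integral_fibre Gtop GT2 hnu ux) //.
    exact: measurable_esqabs.
  by move=> g; rewrite lee_fin sqabs_ge0.
have [_ _ ip] := fc_L2 hh psi; have [_ _ iq] := fc_L2 hh phi.
rewrite (haar_integral_fibre Gtop GT2 hnu ux).
- rewrite integral_sqabsB //.
  + by rewrite re_hs_distE !(fc_isometry hh).
  + by split; [exact: cD|exact: LD].
  + by split; [exact: cD|exact: LD].
- by apply: measurable_esqabs; exact: cmeasurableB.
- by move=> g; rewrite lee_fin sqabs_ge0.
Qed.

(** The distance of the two vectors is that of their functions in [L^2]. *)
Lemma fibre_ae_inj (psi phi : h) :
  fibre_ae Gd nu x (fs_fun psi) (fs_fun phi) -> psi = phi.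
Proof.
move=> ae; apply/eqP; rewrite -subr_eq0; apply/eqP; apply: rnorm_eq0.
suff : rnorm (psi - phi) ^+ 2 = 0 by move/eqP; rewrite sqrf_eq0 => /eqP.
have := integral_fibre_dist psi phi.
rewrite (@ge0_ae_eq_integral _ (borel G) R (nu x) setT _ (fun=> 0%E)) //.
- by rewrite integral0 => -[].
- apply: measurable_esqabs; apply: cmeasurableB; exact: cmeasurable_fibre_fun.
- by move=> g _; rewrite lee_fin sqabs_ge0.
- move: ae; apply: filterS => g e _; rewrite /fibre_fun e subrr.
  by rewrite /sqabs re0 im0 expr0n addr0.
Qed.

End OneFibre.
End FibreSpaces.

(** * Translates as actions of point masses *)

Section Translates.
Context {R : realType} {G : ptopologicalType} (Gd : groupoid G).
Hypothesis Gtop : topological_groupoid Gd.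
Hypothesis Glc : locally_compact [set: G].
Hypothesis GT2 : hausdorff_space G.
Hypothesis Gsc : @second_countable G.
Context (nu : G -> {measure set (borel G) -> \bar R}).
Hypothesis hnu : haar_system Gd nu.
Context (X : set G).
Hypothesis Xtr : compact_transversal Gd X.
Hypothesis Het : etale_HX Gd X.
Context (sigma : G -> G -> Cplx R).
Hypothesis sigma_coc : normalised_cocycle Gd sigma.
Context (A : cstarAlgebra R) (iA : (G -> Cplx R) -> A).
Context (E : hilbertModule A) (iE : (G -> Cplx R) -> E).
Hypothesis hE : module_completion Gd X sigma nu iA iE.
Context (omega : G -> A -> Cplx R).
Hypothesis omega_state : forall x, X x -> cs_state (omega x).
Context (h : G -> fibre_space G E).
Hypothesis hh : forall x, X x -> fibre_completion Gd X nu iE x (omega x) (h x).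
Local Notation r := (gr Gd).
Local Notation s := (gs Gd).
Local Notation inv := (ginv Gd).
Local Notation mul := (gmul Gd).
Local Notation H := (HX Gd X).

Context (x alpha : G) (b : G -> Cplx R).
Hypothesis Halpha : H alpha.
Hypothesis ralpha : r alpha = x.
Hypothesis Cb : Cc H b.
Hypothesis b1 : b (inv alpha) = 1.
Hypothesis b0 : forall g, H g -> s g = x -> g <> inv alpha -> b g = 0.

Let Xx : X x. Proof. by rewrite -ralpha; case: Halpha. Qed.
Let Xs : X (s alpha). Proof. by case: Halpha. Qed.
Let ux : units Gd x. Proof. exact: tr_units Xx. Qed.

(** Of the sum defining the action, only the term at [alpha] is left. *)
Lemma right_action_point_mass (c : G -> Cplx R) (z : G) : s z = x ->
  right_action Gd X sigma c b z = c (mul z alpha) * sigma (mul z alpha) (inv alpha).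
Proof.
move=> sz; rewrite /right_action -(@fsbig_widen _ _ _ _ [set alpha]).
- by rewrite fsbig_set1 b1 mulr1.
- by move=> _ ->; split => //; rewrite sz.
- move=> g [[Hg rg] ga] /=; rewrite (b0 (g := inv g)) ?mulr0 ?mul0r //.
  + exact: HX_inv.
  + by rewrite g_sV rg.
  + by move=> /(congr1 inv); rewrite !g_invK => e; exact: ga.
Qed.

(* In terms of [tau] and [phase], the translate of the function representing a
   vector is its composite with the measure preserving map [tau], up to a phase. *)
Let tau := translation Gd (inv alpha).
Let phase (g : G) := sigma (mul (inv g) alpha) (inv alpha).

Let inv_tau g : r g = x -> inv (tau g) = mul (inv g) alpha.
Proof.
move=> rg; rewrite /tau /translation mem_set ?/r_fibre /= ?g_sV ?rg //.
by rewrite g_invM ?g_invK // g_sV ralpha.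
Qed.

Let D : set G := r_fibre Gd x.

Let cmeasurable_phase : cmeasurable (T := borel G) D phase.
Proof.
have cphase : {within D, continuous phase}.
  apply: (@within_comp _ _ _ D (composable Gd)
    (fun g => (mul (inv g) alpha, inv alpha)) (fun q => sigma q.1 q.2)).
  - apply: within_pair; last by apply: continuous_subspaceT => ?; exact: cvg_cst.
    apply: (@within_comp _ _ _ D (composable Gd)
      (fun g => (inv g, alpha)) (fun q : G * G => mul q.1 q.2)).
    + apply: within_pair; last by apply: continuous_subspaceT => ?; exact: cvg_cst.
      by apply: continuous_subspaceT; exact: tg_inv.
    + exact: tg_mul.
    + by move=> g rg; rewrite /composable /= g_sV ralpha.
  - exact: coc_continuous.
  - by move=> g rg; rewrite /composable /= g_sM ?g_rV // g_sV ralpha.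
have mD : measurable (D : set (borel G)) by exact: measurable_r_fibre.
move/subspace_continuousP : cphase => cphase.
split; apply: within_borelR => //; apply/subspace_continuousP => g Dg.
  by apply: (cvg_comp _ _ (cphase g Dg)); exact: continuous_re.
by apply: (cvg_comp _ _ (cphase g Dg)); exact: continuous_im.
Qed.

Let sqabs_phase g : r g = x -> sqabs (phase g) = 1.
Proof.
move=> rg; apply: sqabs1; apply: (coc_norm sigma_coc).
by rewrite g_sM ?g_rV // g_sV ralpha.
Qed.

Let Phi (e : E) : G -> Cplx R :=
  fibre_fun Gd (fs_map (h x) (hm_act e (iA b))).
Let Psi (e : E) (g : G) : Cplx R :=
  fibre_fun Gd (fs_map (h (s alpha)) e) (tau g).

Let cmeasurable_Psi e : cmeasurable (T := borel G) setT (Psi e).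
Proof.
have [m1 m2] := cmeasurable_fibre_fun Gtop (hh Xs) (fs_map (h (s alpha)) e).
have mt := measurable_translation Gtop GT2 (inv alpha).
by split; [exact: (measurableT_comp m1 mt)|exact: (measurableT_comp m2 mt)].
Qed.

Let cmeasurable_Phi e : cmeasurable (T := borel G) setT (Phi e).
Proof. exact: (cmeasurable_fibre_fun Gtop (hh Xx)). Qed.

(** For compactly supported functions the translate is the action of the point
    mass, by the formula for the action. *)
Let translate_Cc (c : G -> Cplx R) : Cc (GX Gd X) c ->
  {ae nu x, forall g : borel G, D g -> Phi (iE c) g = Psi (iE c) g * phase g}.
Proof.
move=> Cgc.
have Cr : Cc (GX Gd X) (right_action Gd X sigma c b) by exact: Cc_right_action.
have ae1 : {ae nu x, forall g : borel G,
    Phi (iE c) g = right_action Gd X sigma c b (inv g)}.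
  by have := fc_restr (hh Xx) Cr; rewrite (mc_act hE).
have ae2 : {ae nu x, forall g : borel G, Psi (iE c) g = c (inv (tau g))}.
  have [N [mN N0 subN]] := fc_restr (hh Xs) Cgc.
  exists (tau @^-1` N); split.
  - rewrite -[X in measurable X]setTI.
    exact: (measurable_translation Gtop GT2 (inv alpha)).
  - have := haar_translation Gtop Glc GT2 Gsc hnu (inv alpha) mN.
    by rewrite g_rV g_sV ralpha N0.
  - by move=> g /= ng; apply: subN.
apply: filterS2 ae1 ae2 => g e1 e2 rg.
rewrite e1 e2 inv_tau // right_action_point_mass //.
by rewrite g_sV.
Qed.

Let distance (e : E) : \bar R :=
  (\int[nu x]_(g in D) (sqabs (Phi e g - Psi e g * phase g))%:E)%E.

(** Insert the vectors of the compactly supported function [c], for which the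
    distance vanishes.  What is left are the distances of the images of [e] and
    [c], which are bounded on one side by the norm of the point mass and on the
    other side by the invariance of the measures. *)
Let distance_le (e : E) (c : G -> Cplx R) : Cc (GX Gd X) c ->
  (distance e <= (2 * (rnorm (e - iE c) * rnorm (iA b)) ^+ 2 +
    2 * rnorm (e - iE c) ^+ 2)%:E)%E.
Proof.
move=> Cgc.
have mD : measurable (D : set (borel G)) by exact: measurable_r_fibre.
have cD f : cmeasurable (T := borel G) setT f -> cmeasurable (T := borel G) D f.
  by move=> [? ?]; split; exact: measurable_funTS.
pose F1 g := sqabs (Phi e g - Phi (iE c) g).
pose F2 g := sqabs (Psi (iE c) g - Psi e g).
have mF1 : measurable_fun setT (fun g : borel G => (F1 g)%:E).
  by apply: measurable_esqabs; exact: cmeasurableB.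
have mF2 : measurable_fun setT (fun g : borel G => (F2 g)%:E).
  by apply: measurable_esqabs; exact: cmeasurableB.
have F1ge0 g : 0 <= F1 g by exact: sqabs_ge0.
have F2ge0 g : 0 <= F2 g by exact: sqabs_ge0.
have I1 : (\int[nu x]_(g in D) (F1 g)%:E <= ((rnorm (e - iE c) * rnorm (iA b)) ^+ 2)%:E)%E.
  rewrite -(haar_integral_fibre Gtop GT2 hnu ux) //.
  rewrite /F1 (integral_fibre_dist Gtop GT2 hnu Xtr Xx (hh Xx)) lee_fin.
  rewrite -(fs_mapB (hh Xx)) -hm_actBl.
  rewrite lerXn2r ?nnegrE ?mulr_ge0 ?rnorm_ge0 //.
  apply: le_trans (rnorm_fs_map (omega_state Xx) (hh Xx) _) _.
  exact: rnorm_act.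
have I2 : (\int[nu x]_(g in D) (F2 g)%:E <= (rnorm (e - iE c) ^+ 2)%:E)%E.
  rewrite -(haar_integral_fibre Gtop GT2 hnu ux) //.
  have := @haar_integral_translation R G Gd Gtop Glc GT2 Gsc nu hnu (inv alpha)
    (fun g => (sqabs (fibre_fun Gd (fs_map (h (s alpha)) (iE c)) g -
      fibre_fun Gd (fs_map (h (s alpha)) e) g))%:E).
  rewrite g_rV g_sV ralpha => <-.
  - rewrite (integral_fibre_dist Gtop GT2 hnu Xtr Xs (hh Xs)) lee_fin.
    rewrite -(fs_mapB (hh Xs)) (rnorm_distC e).
    rewrite lerXn2r ?nnegrE ?rnorm_ge0 //.
    exact: (rnorm_fs_map (omega_state Xs) (hh Xs)).
  - apply: measurable_esqabs; apply: cmeasurableB; exact: (cmeasurable_fibre_fun Gtop (hh Xs)).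
  - by move=> g; rewrite lee_fin sqabs_ge0.
have mD2 F : measurable_fun setT (fun g : borel G => (F g)%:E) ->
    measurable_fun (D : set (borel G)) (fun g => (2 * F g)%:E).
  move=> mF; apply: measurable_funTS.
  under eq_fun do rewrite EFinM; exact: measurable_funeM.
apply: (@le_trans _ _ (\int[nu x]_(g in D) ((2 * F1 g)%:E + (2 * F2 g)%:E))%E).
  apply: ae_ge0_le_integral => //.
  - by move=> g _; rewrite lee_fin sqabs_ge0.
  - apply: measurable_esqabs; apply: cmeasurableB; first exact: cD.
    by apply: cmeasurableM => //; exact: cD.
  - by move=> g _; rewrite -EFinD lee_fin addr_ge0 // mulr_ge0.
  - by apply: emeasurable_funD; exact: mD2.
  - have := translate_Cc Cgc; apply: filterS => g eg Dg.
    rewrite -EFinD lee_fin.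
    have -> : Phi e g - Psi e g * phase g =
      (Phi e g - Phi (iE c) g) + (Psi (iE c) g - Psi e g) * phase g.
      by rewrite eg //; ring.
    apply: le_trans (sqabsD_le _ _ ltr01) _.
    by rewrite invr1 sqabsM (sqabs_phase Dg) mulr1.
have Z F : measurable_fun setT (fun g : borel G => (F g)%:E) -> (forall g, 0 <= F g) ->
    (\int[nu x]_(g in D) (2 * F g)%:E = 2%:E * \int[nu x]_(g in D) (F g)%:E)%E.
  move=> mF F0; rewrite -ge0_integralZl_EFin //; last exact: measurable_funTS.
  by move=> g _; rewrite lee_fin.
have -> : (\int[nu x]_(g in D) ((2 * F1 g)%:E + (2 * F2 g)%:E) =
    \int[nu x]_(g in D) (2 * F1 g)%:E + \int[nu x]_(g in D) (2 * F2 g)%:E)%E.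
  apply: ge0_integralD => //; do ?exact: mD2.
    by move=> g _; rewrite lee_fin mulr_ge0.
  by move=> g _; rewrite lee_fin mulr_ge0.
rewrite !Z //.
apply: (@le_trans _ _ (2%:E * ((rnorm (e - iE c) * rnorm (iA b)) ^+ 2)%:E +
    2%:E * (rnorm (e - iE c) ^+ 2)%:E)%E).
  by apply: leeD; apply: lee_wpmul2l.
by rewrite -!EFinM -EFinD.
Qed.

(** The translate of an arbitrary vector is its image under the action of the
    point mass: translation and action are both bounded, and they agree on a
    dense subspace. *)
Lemma translate_ae (e : E) : {ae nu x, forall g : borel G, D g -> Phi e g = Psi e g * phase g}.
Proof.
have mD : measurable (D : set (borel G)) by exact: measurable_r_fibre.
have cD f : cmeasurable (T := borel G) setT f -> cmeasurable (T := borel G) D f.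
  by move=> [? ?]; split; exact: measurable_funTS.
have d0 : distance e = 0%E.
  apply/eqP; rewrite eq_le; apply/andP; split; last first.
    by apply: integral_ge0 => g _; rewrite lee_fin sqabs_ge0.
  apply/lee_addgt0Pr => eps eps0; rewrite add0e.
  (* For [t <= 1] the bound of [distance_le] is [t^2 K <= t K]. *)
  pose K := 2 * rnorm (iA b) ^+ 2 + 2.
  have K0 : 0 < K by rewrite /K ltr_wpDl // mulr_ge0 // sqr_ge0.
  have [|_ [c Cgc <-] hc] := @dense_rnorm R E _ e (Num.min 1 (eps / K)) (mc_dense hE).
    by rewrite lt_min ltr01 divr_gt0.
  apply: le_trans (distance_le e Cgc) _; rewrite lee_fin.
  move: hc; rewrite rnorm_distC lt_min => /andP[d1 d2].
  set t := rnorm (e - iE c) in d1 d2 *; have t0 : 0 <= t := rnorm_ge0 _.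
  have -> : 2 * (t * rnorm (iA b)) ^+ 2 + 2 * t ^+ 2 = t * (t * K).
    by rewrite /K; ring.
  apply: (@le_trans _ _ (1 * (t * K))).
    by rewrite ler_wpM2r ?mulr_ge0 // ltW.
  by rewrite mul1r -ler_pdivlMr // ltW.
have : ae_eq (nu x) (D : set (borel G))
    (fun g => (sqabs (Phi e g - Psi e g * phase g))%:E) (cst 0%E).
  apply/ae_eq_integral_abs => //.
    apply: measurable_esqabs; apply: cmeasurableB; first exact: cD.
    by apply: cmeasurableM => //; exact: cD.
  rewrite -d0; apply: eq_integral => g _.
  by rewrite gee0_abs // lee_fin sqabs_ge0.
apply: filterS => g eg Dg; have [e0] := eg Dg.
by apply/eqP; rewrite -subr_eq0; apply/eqP; exact: sqabs_eq0.
Qed.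

(** The defining property of the translate selects one vector at most, by
    [fibre_ae_inj], and [translate_ae] provides one. *)
Lemma translateE (e : E) :
  translate Gd sigma nu h e x alpha = fs_map (h x) (hm_act e (iA b)).
Proof.
have mem : fibre_ae Gd nu x (fs_fun (fs_map (h x) (hm_act e (iA b))))
    (fun y => fs_fun (fs_map (h (s alpha)) e) (mul y alpha) *
              sigma (mul y alpha) (inv alpha)).
  have off : {ae nu x, forall g : borel G, D g}.
    exists (~` D); split; first by apply: measurableC; exact: measurable_r_fibre.
      exact: haar_off_fibre.
    by move=> g.
  apply: filterS2 (translate_ae e) off => g eg Dg.
  have := eg Dg; rewrite /Phi /Psi /fibre_fun inv_tau // => ->.
rewrite /translate; case: xgetP => [phi _ hphi|/(_ _ mem) //].
apply: (fibre_ae_inj Gtop GT2 hnu Xtr Xx (hh Xx)).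
by apply: filterS2 hphi mem => g e1 e2; rewrite e1 e2.
Qed.

End Translates.

(** * The tight frame identity *)

Lemma rnorm_dense {R : realType} (V : normedModType (Cplx R)) (S : set V) :
  (forall v (d : R), 0 < d -> exists2 u, S u & rnorm (u - v) < d) -> dense S.
Proof.
move=> hS O [v Ov] oO; have : nbhs v O by exact: open_nbhs_nbhs.
move=> /nbhs_normP[e e0 eO].
have [|u Su uv] := hS v (re e); first by move: e0; rewrite /= ltCE => /andP[].
exists u; split => //; apply: eO => /=.
by rewrite norm_rnorm ltCE (gt0_realC e0) /= eqxx /= rnorm_distC.
Qed.

Lemma ler_sum_fsubset {R : realType} (I : choiceType) (a : I -> R) (F B : {fset I}) :
  (forall i, 0 <= a i) -> (F `<=` B)%fset -> \sum_(i <- F) a i <= \sum_(i <- B) a i.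
Proof.
move=> a0 /fsubsetP FB; rewrite [leRHS](bigID (mem F)) /=.
have -> : \sum_(i <- B | i \in F) a i = \sum_(i <- F) a i.
  rewrite -big_filter; apply: perm_big.
  apply: uniq_perm; [exact/filter_uniq/fset_uniq|exact: fset_uniq|].
  by move=> i; rewrite mem_filter; apply/andP/idP => [[]//|iF]; split => //; exact: FB.
by rewrite lerDl; apply: sumr_ge0.
Qed.

Section FrameIdentity.
Context {R : realType} {A : cstarAlgebra R} {E : hilbertModule A}.
Context (J : countType) (e_ : J -> E) (w : A -> Cplx R).
Hypothesis state_w : cs_state w.

Let energy (f : E) (j : J) : R :=
  re (w (cs_mul (cs_star (hm_ip (e_ j) f)) (hm_ip (e_ j) f))).

Let energyE (B : {fset J}) (f : E) :
  \sum_(j <- B) energy f j = re (w (hm_ip f (frame_sum e_ B f))).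
Proof.
have ipD u v : hm_ip f (u + v) = hm_ip f u + hm_ip f v by exact: hm_ip_addr.
rewrite /frame_sum (big_morph _ ipD (hm_ip0r f)).
rewrite (big_morph _ (stateD state_w) (state0 state_w)) re_sum.
apply: eq_bigr => j _.
by rewrite /energy /theta hm_ipA hm_ip_star.
Qed.

(** On a vector which the frame reconstructs, the state applied to
    [(f | sum_j e_j (e_j | f))] is at once the sum of the energies of the
    coefficients and the squared seminorm of the vector. *)
Lemma reconstructed_energy (f : E) : reconstructed e_ f ->
  \esum_(j in [set: J]) (re (w (cs_mul (cs_star (hm_ip (e_ j) f)) (hm_ip (e_ j) f))))%:E =
  (re (w (hm_ip f f)))%:E.
Proof.
move=> rf; have G0 j : 0 <= energy f j by exact: re_state_ge0.
have approx (d : R) : 0 < d -> exists B0 : {fset J}, forall B : {fset J},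
    (B0 `<=` B)%fset -> `|\sum_(j <- B) energy f j - re (w (hm_ip f f))| <= d.
  move=> d0; have c0 : 0 < rnorm f + 1 by rewrite ltr_wpDl ?rnorm_ge0.
  have [|B0 hB] := rf (d / (rnorm f + 1)); first by rewrite divr_gt0.
  exists B0 => B /hB; set g := _ - f => hg.
  rewrite energyE -reB -stateB // -hm_ipBr -/g.
  have CS : sqabs (w (hm_ip f g)) <= re (w (hm_ip f f)) * re (w (hm_ip g g)).
    apply: (form_CS (B := fun u v => w (hm_ip u v))) => [k u v z|k u v z|u].
    - by rewrite hm_ipDr state_lin.
    - by rewrite hm_ipDl state_lin.
    - by have [a ->] := hm_ip_pos u; exact: state_ge0.
  have le u : re (w (hm_ip u u)) <= rnorm u ^+ 2.
    by rewrite hm_rnorm; exact: re_state_le.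
  have pos u : 0 <= re (w (hm_ip u u)).
    by have [a ->] := hm_ip_pos u; exact: re_state_ge0.
  have h1 : `|re (w (hm_ip f g))| <= rnorm f * rnorm g.
    rewrite -ler_sqr ?nnegrE ?mulr_ge0 ?rnorm_ge0 // real_normK ?num_real // exprMn.
    apply: (@le_trans _ _ (sqabs (w (hm_ip f g)))); first by rewrite /sqabs lerDl sqr_ge0.
    by apply: le_trans CS _; apply: ler_pM.
  apply: le_trans h1 _; apply: (@le_trans _ _ ((rnorm f + 1) * rnorm g)).
    by rewrite ler_wpM2r ?rnorm_ge0 // lerDl.
  by rewrite mulrC -ler_pdivlMr // ltW.
apply: esum_eq_fset => // [F _|y hy].
- apply/ler_addgt0Pr => d d0; have [B0 hB] := approx d d0.
  have := hB (F `|` B0)%fset (fsubsetUr _ _); rewrite ler_norml => /andP[_].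
  rewrite lerBlDl => h; apply: le_trans h.
  by apply: ler_sum_fsubset => //; exact: fsubsetUl.
- apply/ler_addgt0Pr => d d0; have [B0 hB] := approx d d0.
  have := hB B0 (fsubset_refl _); rewrite ler_norml => /andP[+ _].
  rewrite lerBrDr addrC lerBlDr => h; apply: le_trans h _.
  by rewrite lerD2r; exact: hy.
Qed.
End FrameIdentity.

Theorem proposition4p4
  (R : realType) (G : ptopologicalType) (Gd : groupoid G)
  (hG_top : topological_groupoid Gd)
  (hG_sc : @second_countable G)
  (hG_lc : locally_compact [set: G])
  (hG_T2 : hausdorff_space G)
  (nu : G -> {measure set (borel G) -> \bar R})
  (hnu : haar_system Gd nu)
  (X : set G)
  (hX : compact_transversal Gd X)
  (hH : etale_HX Gd X)
  (sigma : G -> G -> Cplx R)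
  (hsigma : normalised_cocycle Gd sigma)
  (A : cstarAlgebra R) (iA : (G -> Cplx R) -> A)
  (hA : reduced_completion Gd X sigma iA)
  (E : hilbertModule A) (iE : (G -> Cplx R) -> E)
  (hE : module_completion Gd X sigma nu iA iE)
  (omega : G -> A -> Cplx R)
  (homega : forall x, X x -> evaluation_state Gd X iA x (omega x))
  (h : G -> fibre_space G E)
  (hh : forall x, X x -> fibre_completion Gd X nu iE x (omega x) (h x))
  (J : countType) (e_ : J -> E)
  (he : module_frame e_) :
  forall x : G, X x ->
    normalised_tight_frame
      [set p : J * G | HX Gd X p.2 /\ gr Gd p.2 = x]
      (fun p : J * G => translate Gd sigma nu h (e_ p.1) x p.2).
Proof.
move=> x Xx psi; rewrite rnorm_sqr.
have state_w : forall y, X y -> cs_state (omega y) by move=> y /homega[].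
set M := fs_map (h x); set w := omega x.
have [b hb] := exists_point_masses (R := R) hG_top hG_lc hG_T2 hX hH x.
have tE p : HX Gd X p.2 /\ gr Gd p.2 = x ->
    translate Gd sigma nu h (e_ p.1) x p.2 = M (hm_act (e_ p.1) (iA (b p.2))).
  move=> [Hp rp]; have [cb b1 b0] := hb p.2 (conj Hp rp).
  exact: (translateE hG_top hG_lc hG_T2 hG_sc hnu hX hH hsigma hE state_w hh Hp rp cb b1 b0).
apply: (parseval_dense (S := M @` reconstructed e_)
  (l := fun p v => hs_ip (translate Gd sigma nu h (e_ p.1) x p.2) v)
  (q := fun v => rnorm v ^+ 2)).
- by move=> p _ u v; rewrite hs_ipBr.
- move=> p _; exists (rnorm (translate Gd sigma nu h (e_ p.1) x p.2) ^+ 2) => v.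
  exact: hs_CS.
- move=> v; apply: (@continuous_comp _ _ _ (@rnorm R (h x)) (fun t : R => t ^+ 2)).
    exact: continuous_rnorm.
  exact: exprn_continuous.
- by rewrite rnorm0 expr0n.
- apply: rnorm_dense => v d d0.
  have d2 : 0 < d / 2 by rewrite divr_gt0.
  have [_ [e _ <-] ev] := dense_rnorm v (fc_dense (hh x Xx)) d2.
  have kad := state_kadison hG_top hG_T2 hX hH hsigma hA Xx (homega x Xx).
  have rt (u u' g : E) : reconstructed e_ (theta u u' g) by exact: reconstructed_theta.
  have e2 : 0 < (d / 2) ^+ 2 by rewrite exprn_gt0.
  have [f rf hf] := rank_one_dense (state_w x Xx) kad (reconstructed0 e_)
     (@reconstructed_lin _ _ _ _ e_) rt e e2.
  exists (M f); first by exists f.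
  rewrite [d]splitr -(subrK (M e) (M f)) -addrA.
  apply: le_lt_trans (rnormD _ _) _; apply: ltrD ev.
  rewrite rnorm_distC -(fs_mapB (hh x Xx)) -ltr_sqr ?nnegrE ?rnorm_ge0 ?(ltW d2) //.
  by rewrite (rnorm_fs_map_sqr (hh x Xx)).
- move=> _ [f rf <-].
  rewrite (rnorm_fs_map_sqr (hh x Xx)) -(reconstructed_energy (state_w x Xx) rf).
  have -> : [set p : J * G | HX Gd X p.2 /\ gr Gd p.2 = x] =
    [set: J] `*`` (fun=> [set z | HX Gd X z /\ gr Gd z = x]).
    by apply/seteqP; split => p /= => [[]|[_ []]].
  rewrite -(esum_esum (a := fun j z => (sqabs (hs_ip (translate Gd sigma nu h (e_ j) x z) (M f)))%:E));
    last by move=> *; rewrite lee_fin sqabs_ge0.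
  apply: eq_esum => j _.
  rewrite -(state_parseval hG_top hG_T2 hX hH hsigma hA Xx (homega x Xx) hb).
  apply: eq_esum => z Fz; congr (sqabs _)%:E.
  rewrite (tE (j, z) Fz) (fc_ip (hh x Xx)) hm_ipAl //.
Qed.
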